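(* Let $X$ be a scalar L\'evy process with triple $(m,0,\nu)$, let $0<\varepsilon<1$, and let $X^\varepsilon_t=\int_0^t\int_{|z|>\varepsilon}z\,J(dz,ds)$ be the compound Poisson process of jumps of $X$ of size larger than $\varepsilon$, with intensity $\lambda_\varepsilon=\int_{|z|>\varepsilon}\nu(dz)$. For $x>0$ put $\lambda_x=\int_{|z|>x}\nu(dz)$ and, for $p>1$, $L_\varepsilon(p)=p\int_{x>\varepsilon}x^{p-1}\lambda_x^2\,dx$. Then for every $p>1$ there is a constant $K_p$ depending only on $p$ such that for all $n\ge1$ and $\varepsilon$ with $0<\lambda_\varepsilon\le n$, $$\mathbb E\Big[\Big(\sup_{0\le t\le 1/n}X^\varepsilon_t-\big(X^\varepsilon_{1/n}\big)^+\Big)^p\Big]\le K_p\Big(\varepsilon^p+\frac{L_\varepsilon(p)}{\lambda_\varepsilon^2}\Big)\frac{\lambda_\varepsilon^2}{n^2}.$$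
   Context: $J$ is the jump (Poisson random) measure of $X$ and $\nu$ its L\'evy measure; $X^\varepsilon_0=0$. *)

(* Defs.v *)
From HB Require Import structures.
From mathcomp Require Import all_boot all_order all_algebra.
From mathcomp Require Import all_classical all_reals all_analysis.
Set Implicit Arguments. Unset Strict Implicit. Unset Printing Implicit Defensive.
Import Order.TTheory GRing.Theory Num.Theory.
Import numFieldNormedType.Exports.
Local Open Scope classical_set_scope.
Local Open Scope ring_scope.

Section Levy.
Context {R : realType} {d : measure_display} {T : measurableType d}.

Definition levy_measure (nu : {measure set R -> \bar R}) : Prop :=
  nu [set 0] = 0%E /\ (\int[nu]_z (Num.min 1 (z ^+ 2))%:E < +oo)%E.

Definition indep_rvs (P : probability T R) (k : nat) (Y : 'I_k -> T -> R) : Prop :=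
  forall B : 'I_k -> set R, (forall i, measurable (B i)) ->
    P (\bigcap_(i in [set: 'I_k]) (Y i @^-1` B i)) =
    (\prod_(i < k) P (Y i @^-1` B i))%E.

(* Levy–Khintchine exponent pieces for the triple (m, 0, nu):
   E[exp(iuX_t)] = exp(t(ium - int (1 - e^{iuz} + iuz 1_{|z|<=1}) nu(dz))) *)
Definition lk_re (nu : {measure set R -> \bar R}) (u : R) : R :=
  fine (\int[nu]_z (1 - cos (u * z))%:E).
Definition lk_im (nu : {measure set R -> \bar R}) (u : R) : R :=
  fine (\int[nu]_z (sin (u * z) - (if `|z| <= 1 then u * z else 0))%:E).

Definition levy_process (P : probability T R) (X : R -> T -> R)
    (m : R) (nu : {measure set R -> \bar R}) : Prop :=
  (forall w, X 0 w = 0) /\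
      (forall t, measurable_fun setT (X t)) /\
      (forall w t, 0 <= t -> X ^~ w @ t^'+ --> X t w) /\
      (forall w t, 0 < t -> cvg (X ^~ w @ t^'-)) /\
      (forall (k : nat) (t : nat -> R), 0 <= t 0 ->
         (forall i, (i < k)%N -> t i < t i.+1) ->
         indep_rvs P (fun i : 'I_k => fun w => X (t i.+1) w - X (t i) w)) /\
      (forall s t B, 0 <= s -> 0 <= t -> measurable B ->
         P [set w | X (s + t) w - X s w \in B] = P [set w | X t w \in B]) /\
      (forall t u, 0 <= t ->
         (\int[P]_w (cos (u * X t w))%:E =
            (expR (- (t * lk_re nu u)) * cos (t * (u * m + lk_im nu u)))%:E)%E /\
         (\int[P]_w (sin (u * X t w))%:E =
            (expR (- (t * lk_re nu u)) * sin (t * (u * m + lk_im nu u)))%:E)%E).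

Definition jump (X : R -> T -> R) (w : T) (s : R) : R :=
  X s w - lim (X ^~ w @ s^'-).

(* X^eps_t = int_0^t int_{|z|>eps} z J(dz,ds), J the jump measure of X:
   the sum of the jumps of size > eps on (0, t] *)
Definition Xeps (X : R -> T -> R) (eps t : R) (w : T) : R :=
  \sum_(s \in [set s | 0 < s <= t /\ eps < `|jump X w s|]) jump X w s.

End Levy.

Definition lambda_tail {R : realType} (nu : {measure set R -> \bar R}) (x : R)
  : \bar R := nu [set z | x < `|z|].

Definition L_eps {R : realType} (nu : {measure set R -> \bar R}) (eps p : R)
  : \bar R :=
  (p%:E * \int[lebesgue_measure]_(x in [set x | (eps < x)%R])
            ((x `^ (p - 1))%:E * (lambda_tail nu x) ^+ 2))%E.

(* Main.v *)
Require Import Defs.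
From HB Require Import structures.
From mathcomp Require Import all_boot all_order all_algebra.
From mathcomp Require Import all_classical all_reals all_analysis.
From mathcomp Require Import measurable_realfun ring lra.
Import Order.TTheory GRing.Theory Num.Theory.
Import numFieldNormedType.Exports.
Local Open Scope classical_set_scope.
Local Open Scope ring_scope.

(** Let h = 1/n, let N be the number of jumps of size > eps in (0, h] and N_x
    the number of those of size > x. A partial sum of the jumps exceeds the
    positive part of the total by at most the sum of the |jumps| without the
    largest one, hence by at most N times the second largest. Splitting
    according to the dyadic size of the latter,
      overshoot^p <= p^p sum_j (2^(j+1) eps)^p e^N 1(N_(2^j eps) >= 2),
    so that it suffices to prove E[e^N 1(N_x >= 2)] <= C (h lambda_x)^2 for
    x >= eps and to compare the dyadic sum with the integral L_eps.

    The expectation is estimated without constructing the Poisson measure of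
    the jumps: along the grids of mesh h/k the jumps are limits of increments,
    which are i.i.d., so by Fatou's lemma only the one-dimensional bound
      limsup_k k P(y < |X_(h/k)| <= M) <= h lambda_x   (x < y <= M)
    is needed. It follows from the Levy-Khintchine formula by testing with
    polynomials in cos(pi z / M) that vanish at z = 0. *)

Set Implicit Arguments.
Unset Strict Implicit.
Unset Printing Implicit Defensive.

(** * Trigonometric test functions *)

(** Constants are left out: every member is [O(min(1, z^2))], hence integrable against a Levy
    measure, which may be infinite near 0. Only real parts of characteristic functions are ever
    needed. *)
Inductive cosine_span {R : realType} : (R -> R) -> Prop :=
| CosineBase u : cosine_span (fun z => 1 - cos (u * z))
| CosineAdd f g : cosine_span f -> cosine_span g ->
    cosine_span (fun z => f z + g z)
| CosineScale a f : cosine_span f -> cosine_span (fun z => a * f z).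

(** By bilinearity two generators suffice, and there the product formula for cosines gives [(1 - cos
    a)(1 - cos b) = (1 - cos a) + (1 - cos b) - ((1 - cos(a + b)) + (1 - cos(a - b))) / 2]. *)
Lemma cosine_span_mul {R : realType} (f g : R -> R) :
  cosine_span f -> cosine_span g -> cosine_span (fun z => f z * g z).
Proof.
move=> hf hg; elim: hf => {f} [u|f1 f2 _ IH1 _ IH2|a f _ IH].
- elim: hg => {g} [v|g1 g2 _ IH1 _ IH2|a g _ IH].
  + have := CosineAdd (CosineAdd (CosineBase u) (CosineBase v))
      (CosineScale (- 2^-1)
        (CosineAdd (CosineBase (u + v)) (CosineBase (u - v)))).
    congr cosine_span; apply/funext => z.
    by rewrite mulrBl mulrDl cosD cosB; field.
  + by have := CosineAdd IH1 IH2; congr cosine_span; apply/funext => z; ring.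
  + by have := CosineScale a IH; congr cosine_span; apply/funext => z; ring.
- by have := CosineAdd IH1 IH2; congr cosine_span; apply/funext => z; ring.
- by have := CosineScale a IH; congr cosine_span; apply/funext => z; ring.
Qed.

Lemma cosine_span_exp {R : realType} (f : R -> R) n :
  cosine_span f -> cosine_span (fun z => f z ^+ n.+1).
Proof.
move=> hf; elim: n => [|n IH]; first by under eq_fun do rewrite expr1.
by under eq_fun do rewrite exprS; exact: cosine_span_mul.
Qed.

(** With [g_k = 1 - (1 - f)^k] one has [g_(k+1) = g_k + f - f g_k], so no constant term appears. *)
Lemma cosine_span_onem_exp {R : realType} (f : R -> R) k :
  cosine_span f -> cosine_span (fun z => 1 - (1 - f z) ^+ k).
Proof.
move=> hf; elim: k => [|k IH].
  have := CosineScale 0 hf; congr cosine_span; apply/funext => z.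
  by rewrite expr0; ring.
have := CosineAdd (CosineAdd IH hf) (CosineScale (-1) (cosine_span_mul hf IH)).
by congr cosine_span; apply/funext => z; rewrite exprS; ring.
Qed.

Lemma bernoulli_le {R : realType} (x : R) k : 0 <= x <= 1 ->
  1 - (1 - x) ^+ k <= k%:R * x.
Proof.
move=> /andP[x0 x1]; elim: k => [|k IH]; first by rewrite expr0 mul0r subrr.
have : 1 - (1 - x) ^+ k.+1 = (1 - (1 - x) ^+ k) + x * (1 - x) ^+ k.
  by rewrite exprS; ring.
move=> ->; rewrite -natr1 mulrDl mul1r lerD//.
by rewrite ler_piMr// exprn_ile1//; lra.
Qed.

Lemma bernoulli_ge {R : realType} (x : R) k : 0 <= x <= 1 ->
  (1 - x) ^+ k * (1 + k%:R * x) <= 1.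
Proof.
move=> /andP[x0 x1]; elim: k => [|k IH]; first by rewrite expr0; lra.
have h : (1 - x) * (1 + k.+1%:R * x) <= 1 + k%:R * x.
  rewrite -natr1; have : 0 <= (k%:R : R) by [].
  set a : R := k%:R => a0; nra.
apply: le_trans IH.
by rewrite exprS [_ * _ ^+ k]mulrC -mulrA ler_wpM2l// exprn_ge0//; lra.
Qed.

(* The step function 1 - (1 - d^n)^k of the Brosowski-Deutsch proof of the
   Stone-Weierstrass theorem, with k close to b^n and a < 1/b < a'. *)
Lemma polynomial_step {R : realType} (a a' eta : R) :
  0 <= a -> a < a' -> a' <= 1 -> 0 < eta ->
  exists n k, forall d : R, 0 <= d <= 1 ->
  [/\ 0 <= 1 - (1 - d ^+ n.+1) ^+ k <= 1,
      d <= a -> 1 - (1 - d ^+ n.+1) ^+ k <= eta * d &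
      a' <= d -> 1 - eta <= 1 - (1 - d ^+ n.+1) ^+ k].
Proof.
move=> a0 aa' a'1 e0.
pose c := (a + a') / 2.
have c0 : 0 < c by rewrite /c; lra.
have cV : 0 < c^-1 by rewrite invr_gt0.
have ac : `|a / c| < 1.
  have q0 : 0 <= a / c by rewrite divr_ge0// ltW.
  by rewrite ger0_norm// ltr_pdivrMr// mul1r /c; lra.
have ca : `|c / a'| < 1.
  have q0 : 0 <= c / a' by rewrite divr_ge0//; lra.
  rewrite ger0_norm//.
  by rewrite ltr_pdivrMr ?mul1r /c; lra.
have an : `|a| < 1 by rewrite ger0_norm; lra.
have /cvgr_dist_lt H1 := cvg_expr ac.
have /cvgr_dist_lt H2 := cvg_expr ca.
have /cvgr_dist_lt H3 := cvg_expr an.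
(* For [d <= a] the step will be at most [k d^n d], with [k d^n <= (c^-(n+1) + 1) a^n = c^-1 (a/c)^n
   + a^n]; each of the two summands gets [eta / 2]. *)
have e1 : 0 < eta * c / 2 by rewrite divr_gt0// mulr_gt0.
have e2 : 0 < eta / 2 by rewrite divr_gt0.
near \oo => n.
have h1 : (a / c) ^+ n < eta * c / 2.
  have : `|0 - (a / c) ^+ n| < eta * c / 2 by near: n; exact: H1.
  by rewrite sub0r normrN ger0_norm ?exprn_ge0// divr_ge0// ltW.
have h2 : (c / a') ^+ n.+1 < eta.
  have : `|0 - (c / a') ^+ n| < eta by near: n; exact: H2.
  have q0 : 0 <= c / a' by rewrite divr_ge0// 1?ltW//; lra.
  rewrite sub0r normrN ger0_norm ?exprn_ge0//; apply: le_lt_trans.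
  rewrite exprS ler_piMl ?exprn_ge0// ltW// (le_lt_trans _ ca)//.
  by rewrite ger0_norm.
have h3 : a ^+ n < eta / 2.
  have : `|0 - a ^+ n| < eta / 2 by near: n; exact: H3.
  by rewrite sub0r normrN ger0_norm ?exprn_ge0.
pose k := (Num.truncn (c^-1 ^+ n.+1)).+1.
have kge : c^-1 ^+ n.+1 <= k%:R.
  by rewrite ltW// truncnS_gt.
have kle : k%:R <= c^-1 ^+ n.+1 + 1.
  by rewrite /k -natr1 lerD2r truncn_le exprn_ge0// ltW.
exists n, k => d /andP[d0 d1].
have dn0 : 0 <= d ^+ n.+1 by rewrite exprn_ge0.
have dn1 : d ^+ n.+1 <= 1 by rewrite exprn_ile1.
have dn01 : 0 <= d ^+ n.+1 <= 1 by rewrite dn0 dn1.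
split.
- apply/andP; split; last by rewrite lerBlDr lerDl exprn_ge0// subr_ge0.
  by rewrite subr_ge0 exprn_ile1//; lra.
(* One factor [d] of [d^(n+1)] is kept, so that the error is [eta * d]: a constant [eta] would not
   be integrable against an infinite measure. *)
- move=> da; apply: (le_trans (bernoulli_le k dn01)).
  rewrite exprS mulrCA [eta * d]mulrC ler_wpM2l//.
  have dan : d ^+ n <= a ^+ n by rewrite lerXn2r ?nnegrE.
  have dn : 0 <= d ^+ n by rewrite exprn_ge0.
  apply: (@le_trans _ _ ((c^-1 ^+ n.+1 + 1) * a ^+ n)).
    by apply: ler_pM.
  rewrite mulrDl mul1r exprSr mulrAC -exprMn mulrC [_^-1 * a]mulrC.
  have : c^-1 * (a / c) ^+ n <= eta / 2.
    apply: le_trans (_ : c^-1 * (eta * c / 2) <= _).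
      by rewrite ler_wpM2l ?ltW.
    by rewrite mulrC mulrAC mulfK// gt_eqF.
  lra.
- move=> ad; rewrite lerD2l lerN2.
  have kd : (a' / c) ^+ n.+1 <= k%:R * d ^+ n.+1.
    rewrite exprMn mulrC; apply: ler_pM => //.
    - by rewrite exprn_ge0// ltW.
    - by rewrite exprn_ge0//; lra.
    - by rewrite lerXn2r ?nnegrE//; lra.
  have q0 : 0 < (a' / c) ^+ n.+1 by rewrite exprn_gt0// divr_gt0//; lra.
  (* Here [(1 - x)^k <= 1 / (1 + k x)] with [x = d^(n+1)], and [k x >= (a'/c)^(n+1) > 1 / eta]. *)
  have := bernoulli_ge k dn01; rewrite -ler_pdivlMr; last by lra.
  move=> /le_trans; apply; rewrite div1r.
  apply: (@le_trans _ _ ((a' / c) ^+ n.+1)^-1).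
    by rewrite lef_pV2 ?posrE//; lra.
  by rewrite -exprVn invf_div ltW.
Unshelve. all: by end_near. Qed.

(** * Small-time asymptotics of the marginal laws *)

Lemma norm_sin_le {R : realType} (x : R) : `|sin x| <= `|x|.
Proof.
wlog x0 : x / 0 <= x.
  move=> H; have [/H//|x0] := leP 0 x.
  have := H (- x); rewrite sinN !normrN; apply; lra.
have csin : {within `[0, x], continuous (@sin R)}.
  by apply: continuous_subspaceT; exact: continuous_sin.
have [c _] := MVT_segment x0 (fun y _ => is_derive_sin y) csin.
rewrite sin0 !subr0 => ->; rewrite normrM ler_piMl//; exact: cos_max.
Qed.

Lemma one_sub_cos_ge0 {R : realType} (x : R) : 0 <= 1 - cos x.
Proof. by rewrite subr_ge0 cos_le1. Qed.

(** The term 2 bounds [1 - cos] globally, and [u^2] comes from [1 - cos v = 2 sin(v/2)^2 <= v^2]. *)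
Lemma one_sub_cos_le {R : realType} (u z : R) :
  1 - cos (u * z) <= (2 + u ^+ 2) * Num.min 1 (z ^+ 2).
Proof.
set v := u * z.
have h2 : 1 - cos v <= 2 by have := cos_geN1 v; lra.
have hv : 1 - cos v <= v ^+ 2.
  have -> : v = (v / 2) *+ 2 by rewrite -mulr_natr; field.
  rewrite cos_mulr2n cos2sin2.
  have : sin (v / 2) ^+ 2 <= (v / 2) ^+ 2.
    by rewrite -[leLHS]real_normK ?num_real// -[leRHS]real_normK ?num_real//
      lerXn2r ?nnegrE// norm_sin_le.
  rewrite -mulr_natr; set s := sin _ ^+ 2; set w := v / 2 => hs.
  rewrite -[_ *+ 2]mulr_natr.
  have := sqr_ge0 w; rewrite exprMn; lra.
have u2 := sqr_ge0 u.
rewrite /Num.min; case: ifPn => _; first lra.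
by have := sqr_ge0 z; rewrite /v exprMn in hv; lra.
Qed.

Lemma measurable_one_sub_cos {R : realType} (u : R) :
  measurable_fun [set: R] (fun z : R => 1 - cos (u * z)).
Proof.
apply: continuous_measurable_fun => z.
apply: cvgB; first exact: cvg_cst.
apply: (continuous_comp (f := fun z => u * z)); last exact: continuous_cos.
by apply: cvgM; [exact: cvg_cst|exact: cvg_id].
Qed.

Section cosine_span_integral.
Context {R : realType} {d : measure_display} {T : measurableType d}.
Context (mu : {measure set T -> \bar R}) (Z : T -> R).
Hypothesis mZ : measurable_fun [set: T] Z.
Hypothesis Zfin : (\int[mu]_z (Num.min 1 (Z z ^+ 2))%:E < +oo)%E.

Lemma integrable_min_sqr :
  mu.-integrable [set: T] (EFin \o (fun z => Num.min 1 (Z z ^+ 2))).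
Proof.
apply/integrableP; split.
  apply/measurable_EFinP; apply: measurable_minr => //.
  exact: measurable_funX.
apply: le_lt_trans Zfin.
rewrite (eq_integral (fun z => (Num.min 1 (Z z ^+ 2))%:E))// => z _ /=.
by rewrite ger0_norm// le_min ler01 sqr_ge0.
Qed.

Lemma integrable_one_sub_cos (u : R) :
  mu.-integrable [set: T] (EFin \o (fun z => 1 - cos (u * Z z))).
Proof.
apply: (@le_integrable _ _ _ _ _ _ _
    (fun z => ((2 + u ^+ 2)%:E * (Num.min 1 (Z z ^+ 2))%:E)%E)) => //.
- apply/measurable_EFinP.
  by apply: (measurableT_comp (measurable_one_sub_cos u)).
- move=> z _ /=; rewrite lee_fin ger0_norm ?one_sub_cos_ge0//.
  rewrite ger0_norm ?one_sub_cos_le//.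
  by rewrite mulr_ge0 ?le_min ?ler01 ?sqr_ge0// addr_ge0// sqr_ge0.
- by apply: integrableZl => //; exact: integrable_min_sqr.
Qed.

(** Stated for a general map [Z] so as to serve both the Levy measure, with the identity, and [P],
    with a marginal of the process. *)
Lemma cosine_span_integrable (f : R -> R) : cosine_span f ->
  mu.-integrable [set: T] (EFin \o (fun z => f (Z z))).
Proof.
elim=> {f} [u|f g _ mf _ mg|a f _ mf]; first exact: integrable_one_sub_cos.
- exact: (integrableD measurableT mf mg).
- exact: (integrableZl measurableT a mf).
Qed.

End cosine_span_integral.

Lemma probability_min_sqr {R : realType} d (T : measurableType d)
    (P : probability T R) (Y : T -> R) : measurable_fun [set: T] Y ->
  (\int[P]_w (Num.min 1 (Y w ^+ 2))%:E < +oo)%E.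
Proof.
move=> mY; apply: (@le_lt_trans _ _ (\int[P]_w (cst 1%E w))%E).
  apply: ge0_le_integral => //=.
  - by move=> w _; rewrite lee_fin le_min ler01 sqr_ge0.
  - apply/measurable_EFinP; apply: measurable_minr => //.
    exact: measurable_funX.
  - by move=> w _; rewrite lee_fin ge_min lexx.
by rewrite integral_cst// mul1e (@le_lt_trans _ _ 1%E) ?probability_le1 ?ltry.
Qed.

Section cosine_span_cvg.
Context {R : realType} {d d' : measure_display}.
Context {T : measurableType d} {T' : measurableType d'}.
Context (P : probability T R) (Y : nat -> T -> R).
Context (mu : {measure set T' -> \bar R}) (Z : T' -> R) (h : R).
Hypotheses (mY : forall k, measurable_fun [set: T] (Y k))
  (mZ : measurable_fun [set: T'] Z)
  (Zfin : (\int[mu]_z (Num.min 1 (Z z ^+ 2))%:E < +oo)%E).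
Hypothesis cvg_base : forall u,
  k.+1%:R * (\int[P]_w (1 - cos (u * Y k w))) @[k --> \oo] -->
  h * (\int[mu]_z (1 - cos (u * Z z))).

Lemma cosine_span_cvg (f : R -> R) : cosine_span f ->
  k.+1%:R * (\int[P]_w f (Y k w)) @[k --> \oo] -->
  h * (\int[mu]_z f (Z z)).
Proof.
have Yfin k := probability_min_sqr P (mY k).
elim=> {f} [u|f g hf cf hg cg|a f hf cf]; first exact: cvg_base.
- rewrite RintegralD//; [|exact: cosine_span_integrable..].
  rewrite mulrDr.
  under eq_fun => k.
    rewrite RintegralD//; [|exact: cosine_span_integrable..].
    rewrite mulrDr; over.
  exact: cvgD.
- rewrite RintegralZl//; last exact: cosine_span_integrable.
  rewrite mulrCA.
  under eq_fun => k.
    rewrite RintegralZl//; last exact: cosine_span_integrable.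
    rewrite mulrCA; over.
  by apply: cvgM => //; exact: cvg_cst.
Qed.

End cosine_span_cvg.

(** This is minus [h] times the derivative at 0 of [exp(-ta) cos(tb)]. The frequency [b], which will
    carry the drift and the compensator, has no first-order effect. *)
Lemma cvg_damped_cos {R : realType} (a b h : R) : 0 < h ->
  m.+1%:R * (1 - expR (- (h / m.+1%:R * a)) * cos (h / m.+1%:R * b))
    @[m --> \oo] --> h * a.
Proof.
move=> h0.
pose phi (t : R) := expR (- (t * a)) * cos (t * b).
have dphi : is_derive (0 : R) (1 : R) phi (- a).
  have d1 : is_derive (0 : R) 1 (fun t : R => - (t * a)) (- a).
    by apply: is_derive_eq; rewrite scaler0 add0r; rewrite /GRing.scale/= mulr1.
  have d2 : is_derive (0 : R) 1 (fun t : R => t * b) b.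
    by apply: is_derive_eq; rewrite scaler0 add0r; rewrite /GRing.scale/= mulr1.
  have e1 := @is_derive1_comp R expR _ 0 _ _ (is_derive_expR _) d1.
  have e2 := @is_derive1_comp R cos _ 0 _ _ (is_derive_cos _) d2.
  have := is_deriveM e1 e2; congr is_derive.
  by rewrite /= !mul0r oppr0 expR0 cos0 sin0 /GRing.scale/=; ring.
have /cvg_dnbhs_at_right cphi :
    t^-1 * (phi t - phi 0) @[t --> 0^'] --> - a.
  have [ex <-] := dphi; have := ex; rewrite /derivable /derive.
  under eq_fun => t do rewrite /= /GRing.scale/= addr0 mulr1.
  by move=> /cvg_ex[l Hl]; rewrite (cvg_lim _ Hl).
move/cvg_at_rightP : cphi => /(_ (fun m => h / m.+1%:R)) H.
have {}H := H (conj (fun n => divr_gt0 h0 (ltr0Sn R n)) _).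
have -> : (fun m : nat => m.+1%:R * (1 - expR (- (h / m.+1%:R * a)) *
    cos (h / m.+1%:R * b))) = (fun m => - h * ((h / m.+1%:R)^-1 *
    (phi (h / m.+1%:R) - phi 0))).
  apply/funext => m; rewrite /phi !mul0r oppr0 expR0 cos0 invf_div mulr1.
  have hn : h != 0 by rewrite gt_eqF.
  rewrite mulrA [X in _ = X * _](_ : _ = - m.+1%:R); last by field.
  by rewrite mulNr -mulrN opprB.
have -> : h * a = - h * - a by ring.
apply: cvgM; first exact: cvg_cst.
apply: H; rewrite -[0](mulr0 h); apply: cvgM; first exact: cvg_cst.
exact: cvg_harmonic.
Qed.

Section levy_process_small_time.
Context {R : realType} {d : measure_display} {T : measurableType d}.
Context (P : probability T R) (X : R -> T -> R) (m : R).
Context (nu : {measure set R -> \bar R}).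
Hypotheses (hnu : levy_measure nu) (hX : levy_process P X m nu).

Lemma levy_measurable t : measurable_fun [set: T] (X t).
Proof. by case: hX => _ []. Qed.

Lemma levy_one_sub_cos t (u : R) : 0 <= t ->
  \int[P]_w (1 - cos (u * X t w)) =
  1 - expR (- (t * lk_re nu u)) * cos (t * (u * m + lk_im nu u)).
Proof.
move=> t0; have mX := levy_measurable t.
have PT : P [set: T] = 1%E by exact: probability_setT.
have mc : P.-integrable [set: T] (EFin \o (fun w => cos (u * X t w))).
  apply: measurable_bounded_integrable => //.
  - by rewrite (@le_lt_trans _ _ 1%E) ?probability_le1 ?ltry.
  - apply: measurableT_comp.
      by apply: continuous_measurable_fun; exact: continuous_cos.
    exact: measurable_funM.
  - by exists 1; split => [|x Cx w _ /=]; [exact: num_real|rewrite (le_trans (cos_max _))// ltW].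
rewrite RintegralB//; last first.
  by apply: finite_measure_integrable_cst.
rewrite Rintegral_cst// mul1r [fine _](_ : _ = 1); last first.
  exact: (congr1 fine PT).
case: hX => _ [_ [_ [_ [_ [_ /(_ t u t0)[hc _]]]]]].
by rewrite /Rintegral hc.
Qed.

(** On a generator, [lk_re] is the integral of [1 - cos(u z)] against [nu], so the Levy-Khintchine
    formula gives the limit; linearity does the rest. *)
Lemma levy_cosine_span_cvg (h : R) (f : R -> R) : 0 < h -> cosine_span f ->
  k.+1%:R * (\int[P]_w f (X (h / k.+1%:R) w)) @[k --> \oo] -->
  h * (\int[nu]_z f z).
Proof.
move=> h0.
apply: (@cosine_span_cvg R d _ T R P (fun k => X (h / k.+1%:R)) nu id h) => //.
- by move=> k; exact: levy_measurable.
- by case: hnu.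
- move=> u; under eq_fun do rewrite levy_one_sub_cos ?divr_ge0// ?ltW//.
  exact: cvg_damped_cos.
Qed.

End levy_process_small_time.

Lemma integrable_indic_lty {R : realType} d (T : measurableType d)
    (mu : {measure set T -> \bar R}) (A : set T) :
  measurable A -> (mu A < +oo)%E -> mu.-integrable [set: T] (EFin \o \1_A).
Proof.
move=> mA Afin; apply/integrableP; split.
  by apply/measurable_EFinP; exact: measurable_indic.
rewrite (eq_integral (fun z => (\1_A z)%:E)).
  by rewrite integral_indic// setIT.
by move=> z _ /=; rewrite ger0_norm.
Qed.

Lemma Rintegral_indic_le {R : realType} d (T : measurableType d)
    (mu : {measure set T -> \bar R}) (A : set T) (c : R) (g : T -> R) :
  measurable A -> (mu A < +oo)%E -> mu.-integrable [set: T] (EFin \o g) ->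
  (forall z, c * \1_A z <= g z) -> c * fine (mu A) <= \int[mu]_z g z.
Proof.
move=> mA Afin ig cg.
have iA : mu.-integrable [set: T] (EFin \o \1_A).
  exact: integrable_indic_lty.
have -> : c * fine (mu A) = \int[mu]_z (c * \1_A z).
  by rewrite RintegralZl// /Rintegral integral_indic// setIT.
by apply: le_Rintegral => //; exact: (integrableZl measurableT c iA).
Qed.

Lemma Rintegral_le_indicD {R : realType} d (T : measurableType d)
    (mu : {measure set T -> \bar R}) (A : set T) (c : R) (f g : T -> R) :
  measurable A -> (mu A < +oo)%E -> mu.-integrable [set: T] (EFin \o f) ->
  mu.-integrable [set: T] (EFin \o g) ->
  (forall z, g z <= \1_A z + c * f z) ->
  \int[mu]_z g z <= fine (mu A) + c * \int[mu]_z f z.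
Proof.
move=> mA Afin iF ig cg.
have iA : mu.-integrable [set: T] (EFin \o \1_A).
  exact: integrable_indic_lty.
have icf := integrableZl measurableT c iF.
have -> : fine (mu A) + c * \int[mu]_z f z = \int[mu]_z (\1_A z + c * f z).
  by rewrite RintegralD// RintegralZl// /Rintegral integral_indic// setIT.
by apply: le_Rintegral => //; exact: (integrableD measurableT iA icf).
Qed.

(** The frequency [pi / M] maps [[0, M]] onto [[0, pi]], where the cosine decreases. *)
Lemma cos_le_norm {R : realType} (M x y : R) : 0 < M -> `|x| <= `|y| ->
  `|y| <= M -> cos (pi / M * y) <= cos (pi / M * x).
Proof.
move=> M0 xy yM; have p0 : 0 < (pi : R) / M by rewrite divr_gt0// pi_gt0.
have E z : `|pi / M * z| = pi / M * `|z| by rewrite normrM (gtr0_norm p0).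
rewrite -(cos_norm (_ * y)) -(cos_norm (_ * x)) !E.
have h z : `|z| <= M -> pi / M * `|z| \in `[0, pi].
  move=> zM; rewrite in_itv/= mulr_ge0 ?(ltW p0)//=.
  by rewrite mulrAC ler_pdivrMr// ler_wpM2l// pi_ge0.
rewrite leNgt ltr_cos ?h// ?(le_trans xy)//.
by rewrite -leNgt ler_pM2l.
Qed.

Lemma cos_lt_norm {R : realType} (M x y : R) : 0 < M -> `|x| < `|y| ->
  `|y| <= M -> cos (pi / M * y) < cos (pi / M * x).
Proof.
move=> M0 xy yM; have p0 : 0 < (pi : R) / M by rewrite divr_gt0// pi_gt0.
have E z : `|pi / M * z| = pi / M * `|z| by rewrite normrM (gtr0_norm p0).
rewrite -(cos_norm (_ * y)) -(cos_norm (_ * x)) !E.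
have h z : `|z| <= M -> pi / M * `|z| \in `[0, pi].
  move=> zM; rewrite in_itv/= mulr_ge0 ?(ltW p0)//=.
  by rewrite mulrAC ler_pdivrMr// ler_wpM2l// pi_ge0.
by rewrite ltr_cos ?h// ?(le_trans (ltW xy))// ltr_pM2l.
Qed.

Lemma measurable_norm_gt {R : realType} d (T : measurableType d) (Y : T -> R)
  (x : R) : measurable_fun [set: T] Y -> measurable [set z | x < `|Y z|].
Proof.
move=> mY.
rewrite -[X in measurable X]setTI (_ : [set z | _] =
    (fun z => `|Y z|) @^-1` `]x, +oo[%classic).
  by apply: (measurableT_comp (@normr_measurable R setT) mY).
by apply/seteqP; split => z /=; rewrite in_itv/= andbT.
Qed.

Lemma measurable_norm_window {R : realType} d (T : measurableType d)
    (Y : T -> R) (x y : R) : measurable_fun [set: T] Y ->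
  measurable [set z | x < `|Y z| <= y].
Proof.
move=> mY; rewrite -[X in measurable X]setTI (_ : [set z | _] =
    (fun z => `|Y z|) @^-1` `]x, y]%classic).
  by apply: (measurableT_comp (@normr_measurable R setT) mY).
by apply/seteqP; split => z /=; rewrite in_itv.
Qed.

Section small_time_tail.
Context {R : realType} {d : measure_display} {T : measurableType d}.
Context (P : probability T R) (X : R -> T -> R) (m : R).
Context (nu : {measure set R -> \bar R}).
Hypotheses (hnu : levy_measure nu) (hX : levy_process P X m nu).

(** The test function [q] is at most 1 everywhere, at most [e * D] for [|z| <= x], and at least
    [1 - e] for [y < |z| <= M]. Hence its [nu]-integral is at most [lambda_x + e I], while its
    expectation is at least [1 - e] times the probability of the window. Beyond [M], where [D] is no
    longer monotone, [0 <= q <= 1] suffices. *)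
Lemma levy_small_time_tail (x y M eta h : R) :
  0 < h -> 0 < x < y -> y <= M -> 0 < eta -> (lambda_tail nu x < +oo)%E ->
  \forall k \near \oo,
    k.+1%:R * fine (P [set w | y < `|X (h / k.+1%:R) w| <= M]) <=
    h * fine (lambda_tail nu x) + eta.
Proof.
move=> h0 /andP[x0 xy] yM e0 lfin.
have y0 : 0 < y := lt_trans x0 xy.
have M0 : 0 < M := lt_le_trans y0 yM.
pose D (z : R) : R := 2^-1 * (1 - cos (pi / M * z)).
have hD : cosine_span D by apply: CosineScale; exact: CosineBase.
have D01 z : 0 <= D z <= 1.
  have := cos_le1 (pi / M * z); have := cos_geN1 (pi / M * z).
  by rewrite /D; lra.
have iD : nu.-integrable [set: R] (EFin \o D).
  exact: (cosine_span_integrable (@measurable_id _ R setT) hnu.2 hD).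
have I0 : 0 <= \int[nu]_z D z.
  by apply: Rintegral_ge0 => z _; case/andP: (D01 z).
set I := (\int[nu]_z D z) in I0.
set A := fine (lambda_tail nu x).
have A0 : 0 <= A by rewrite fine_ge0// measure_ge0.
(* Chosen so that [e = eta / (2 B)] gives exactly [h A + h e I + eta / 2 = (1 - e)(h A + eta)];
   dividing by [1 - e] then concludes. Since [B >= eta], also [e <= 1/2]. *)
pose B := h * A + eta + h * I.
have B0 : 0 < B by rewrite /B; have := mulr_ge0 (ltW h0) A0;
  have := mulr_ge0 (ltW h0) I0; lra.
pose e := eta / 2 / B.
have e_gt0 : 0 < e by rewrite !divr_gt0.
have eB : e * B = eta / 2 by rewrite /e divfK// gt_eqF.
have Dxy : D x < D y.
  rewrite /D ltr_pM2l ?invr_gt0// ltrD2l ltrN2 cos_lt_norm//.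
    by rewrite !gtr0_norm.
  by rewrite gtr0_norm.
have /andP[Dx0 _] := D01 x; have /andP[_ Dy1] := D01 y.
have [n [k0 step]] := polynomial_step Dx0 Dxy Dy1 e_gt0.
pose q z := 1 - (1 - D z ^+ n.+1) ^+ k0.
have hq : cosine_span q by apply: cosine_span_onem_exp; exact: cosine_span_exp.
have iq : nu.-integrable [set: R] (EFin \o q).
  exact: (cosine_span_integrable (@measurable_id _ R setT) hnu.2 hq).
have qnu : \int[nu]_z q z <= A + e * I.
  apply: (@Rintegral_le_indicD R _ _ nu [set z | x < `|z|]) => //.
    exact: (measurable_norm_gt x (@measurable_id _ R setT)).
  move=> z; have [/andP[q0 q1] hqx _] := step _ (D01 z).
  have /andP[Dz0 _] := D01 z; have eD := mulr_ge0 (ltW e_gt0) Dz0.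
  rewrite indicE; have [zx|zx] := ltP x `|z|.
    by rewrite mem_set//= -[leLHS]addr0 lerD.
  rewrite memNset ?add0r /=; last by apply/negP; rewrite -leNgt.
  apply: hqx; rewrite /D ler_wpM2l// lerD2l lerN2 cos_le_norm//.
    by rewrite (gtr0_norm x0).
  by rewrite gtr0_norm// (le_trans (ltW xy)).
have /cvgr_lt cq := levy_cosine_span_cvg hnu hX h0 hq.
have : h * (\int[nu]_z q z) < h * A + h * (e * I) + eta / 2.
  rewrite -mulrDr; apply: (@le_lt_trans _ _ (h * (A + e * I))).
    by rewrite ler_wpM2l// ltW.
  by rewrite ltrDl divr_gt0.
move=> /cq; apply: filterS => k qk.
set Pk := fine (P _).
have mX := levy_measurable hX (h / k.+1%:R).
have qP : (1 - e) * Pk <= \int[P]_w q (X (h / k.+1%:R) w).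
  apply: Rintegral_indic_le => //.
  - exact: measurable_norm_window.
  - by rewrite (@le_lt_trans _ _ 1%E) ?probability_le1 ?ltry//; exact: measurable_norm_window.
  - by apply: cosine_span_integrable => //; exact: probability_min_sqr.
  move=> w; set z := X _ w; have [/andP[q0 q1] _ hqy] := step _ (D01 z).
  rewrite indicE; have [/andP[yz zM]|yz] := boolP (y < `|z| <= M).
    rewrite mem_set /= ?yz ?zM// mulr1; apply: hqy.
    rewrite /D ler_wpM2l// lerD2l lerN2 cos_le_norm//.
    by rewrite (gtr0_norm y0) ltW.
  by rewrite memNset ?mulr0//=; apply/negP.
have k1 : 0 <= k.+1%:R :> R by [].
have := ler_wpM2l k1 qP; move: qk; set Q := _ * Rintegral _ _ _ => qk.
have Pk0 : 0 <= k.+1%:R * Pk by rewrite mulr_ge0// fine_ge0.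
have e1 : e <= 2^-1.
  by rewrite /e ler_pdivrMr// /B mulrC ler_pM2l ?invr_gt0//;
    have := mulr_ge0 (ltW h0) A0; have := mulr_ge0 (ltW h0) I0; lra.
rewrite mulrCA; move: Pk0; set p := _ * Pk => Pk0 hp.
have {}hp : (1 - e) * p < h * A + h * (e * I) + eta / 2 by exact: le_lt_trans hp qk.
have : (1 - e) * p < (1 - e) * (h * A + eta).
  apply: (lt_le_trans hp).
  have -> : (1 - e) * (h * A + eta) =
      h * A + h * (e * I) + eta - e * B by rewrite /B; ring.
  by rewrite eB; lra.
rewrite ltr_pM2l; last lra.
exact: ltW.
Qed.

End small_time_tail.

(** * Pairs of large increments along a grid *)

Lemma measurable_indic_rv {R : realType} d (T : measurableType d)
    (Y : T -> R) (C : set R) : measurable_fun [set: T] Y -> measurable C ->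
  measurable_fun [set: T] (fun w => \1_C (Y w) : R).
Proof.
move=> mY mC; rewrite (_ : (fun w => _) = \1_(Y @^-1` C)); last first.
  by apply/funext => w; rewrite !indicE; congr (nat_of_bool _)%:R;
     apply/idP/idP; rewrite !inE.
by apply: measurable_indic; rewrite -[X in measurable X]setTI; exact: mY.
Qed.

Section independent_products.
Context {R : realType} {d : measure_display} {T : measurableType d}.
Context (P : probability T R) (k : nat) (Y : 'I_k -> T -> R).
Hypotheses (indepY : indep_rvs P Y) (mY : forall i, measurable_fun [set: T] (Y i)).

Lemma measurable_preimage_rv i (C : set R) : measurable C ->
  measurable (Y i @^-1` C).
Proof. by move=> mC; rewrite -[X in measurable X]setTI; exact: mY. Qed.

Lemma indep_rvs_fine (C : 'I_k -> set R) : (forall i, measurable (C i)) ->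
  P (\bigcap_(i in [set: 'I_k]) (Y i @^-1` C i)) =
  (\prod_(i < k) fine (P (Y i @^-1` C i)))%:E.
Proof.
move=> mC; rewrite indepY// -prodEFin; apply: eq_bigr => i _.
by rewrite fineK// fin_num_measure//; exact: measurable_preimage_rv.
Qed.

(** Expanding the product over the set [J] of indices where the indicator is chosen leaves
    indicators of rectangles [F J], with the whole line outside [J]. Independence of events then
    suffices, and the same expansion read backwards gives the product. *)
Lemma integral_indep_prod (C : 'I_k -> set R) (al be : 'I_k -> R) :
  (forall i, measurable (C i)) -> (forall i, 0 <= al i) ->
  (forall i, 0 <= be i) ->
  (\int[P]_w (\prod_(i < k) (al i * \1_(C i) (Y i w) + be i))%:E =
   (\prod_(i < k) (al i * fine (P (Y i @^-1` C i)) + be i))%:E)%E.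
Proof.
move=> mC al0 be0.
pose E (J : {set 'I_k}) i := if i \in J then C i else setT.
pose c (J : {set 'I_k}) := \prod_i (if i \in J then al i else be i).
have mE J i : measurable (E J i) by rewrite /E; case: ifP.
pose F J := \bigcap_(i in [set: 'I_k]) (Y i @^-1` E J i).
have mF J : measurable (F J).
  by apply: fin_bigcap_measurable => // i _; exact: measurable_preimage_rv.
have c0 J : 0 <= c J by apply: prodr_ge0 => i _; case: ifP.
under eq_integral => w _.
  rewrite bigA_distr (eq_bigr (fun J => c J * \1_(F J) w)); last first.
    move=> J _; rewrite /c indicE.
    have [wF|wF] := boolP (w \in F J).
      rewrite mulr1; apply: eq_bigr => i _; case: ifP => // iJ.
      move: wF; rewrite inE => /(_ i I); rewrite /E /= iJ => wC.
      by rewrite indicE mem_set ?mulr1.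
    rewrite mulr0; have /existsP[i /andP[iJ wC]] :
        [exists i, (i \in J) && (Y i w \notin C i)].
      apply: contraR wF => /existsPn H; rewrite inE => i _; rewrite /E/=.
      have := H i; rewrite negb_and negbK; case: ifP => //= _.
      by rewrite inE.
    rewrite (bigD1 i)//= iJ indicE (negbTE wC) mulr0 mul0r//.
  rewrite -sumEFin; over.
rewrite ge0_integral_sum//; last 2 first.
- move=> J; apply/measurable_EFinP; apply: measurable_funM => //.
- by move=> J w _; rewrite lee_fin mulr_ge0.
rewrite bigA_distr -sumEFin; apply: eq_bigr => J _.
under eq_integral do rewrite EFinM.
rewrite ge0_integralZl ?lee_fin//; do ?by apply/measurable_EFinP; exact: measurable_indic.
have -> : (\int[P]_w (\1_(F J) w)%:E)%E = P (F J) by rewrite integral_indic// setIT.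
rewrite /F indep_rvs_fine// -EFinM; congr EFin.
rewrite /c -big_split/=; apply: eq_bigr => i _; rewrite /E; case: ifP => // _.
by rewrite preimage_setT probability_setT mulr1.
Qed.

End independent_products.

(* [pair_weight A B y] dominates e^#{l | B (y l)} as soon as two of the [y l]
   lie in A; unlike that exponential on that event, it is a sum of products of
   functions of the individual [y l]. *)
Definition pair_factor {R : realType} (A B : set R) (b : bool) (x : R) : R :=
  (if b then expR 1 else expR 1 - 1) * \1_(if b then A else B) x +
  (if b then 0 else 1).

Definition pair_weight {R : realType} {k : nat} (A B : set R)
    (y : 'I_k -> R) : R :=
  \sum_(i < k) \sum_(j < k)
    (if j != i then \prod_(l < k) pair_factor A B ((l == i) || (l == j)) (y l)
     else 0).

Lemma expR1_gt1 {R : realType} : 1 < expR 1 :> R.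
Proof. by rewrite expR_gt1. Qed.

Lemma pair_weight_factor_ge0 {R : realType} (b : bool) (x : R) : 0 <= x ->
  0 <= (if b then expR 1 else expR 1 - 1) * x + (if b then 0 else 1).
Proof.
move=> x0; have := @expR1_gt1 R; case: b => e1; last first.
  by rewrite addr_ge0// mulr_ge0//; lra.
by rewrite addr0 mulr_ge0// expR_ge0.
Qed.

Lemma pair_factor_ge0 {R : realType} (A B : set R) b (x : R) :
  0 <= pair_factor A B b x.
Proof. exact: pair_weight_factor_ge0. Qed.

Lemma pair_weight_ge0 {R : realType} k (A B : set R) (y : 'I_k -> R) :
  0 <= pair_weight A B y.
Proof.
apply: sumr_ge0 => i _; apply: sumr_ge0 => j _; case: ifP => // _.
by apply: prodr_ge0 => l _; exact: pair_factor_ge0.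
Qed.

Section pair_weight_integral.
Context {R : realType} {d : measure_display} {T : measurableType d}.
Context (P : probability T R) (k : nat) (Y : 'I_k -> T -> R).
Hypotheses (indepY : indep_rvs P Y) (mY : forall i, measurable_fun [set: T] (Y i)).
Context (A B : set R) (mA : measurable A) (mB : measurable B).

Let g i j w : R :=
  if j != i then
    \prod_(l < k) pair_factor A B ((l == i) || (l == j)) (Y l w) else 0.

Let mg i j : measurable_fun [set: T] (g i j).
Proof.
rewrite /g; have [_|_] := boolP (j != i); last exact: measurable_cst.
apply: measurable_prod => l _.
apply: measurable_funD => //; apply: measurable_funM => //.
by apply: measurable_indic_rv => //; case: ifP.
Qed.

Let g0 i j w : 0 <= g i j w.
Proof.
by rewrite /g; case: ifP => // _; apply: prodr_ge0 => l _; exact: pair_factor_ge0.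
Qed.

Lemma measurable_pair_weight :
  measurable_fun [set: T] (fun w => pair_weight A B (fun l => Y l w)).
Proof.
apply: (@measurable_sum _ _ _ _ _ _ (fun i w => \sum_(j < k) g i j w)) => i.
exact: measurable_sum.
Qed.

(** Each ordered pair contributes at most [(e a)^2 (1 + (e - 1) b)^k <= e^2 a^2 exp((e - 1) k b)],
    and there are at most [k^2] pairs. *)
Lemma pair_weight_integral_le (a b : R) : 0 <= a -> 0 <= b ->
  (forall l, fine (P (Y l @^-1` A)) = a) ->
  (forall l, fine (P (Y l @^-1` B)) = b) ->
  (\int[P]_w (pair_weight A B (fun l => Y l w))%:E <=
   (expR 1 ^+ 2 * (k%:R * a) ^+ 2 * expR ((expR 1 - 1) * (k%:R * b)))%:E)%E.
Proof.
move=> a0 b0 hA hB.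
have e1 := @expR1_gt1 R.
pose c := expR 1 ^+ 2 * a ^+ 2 * expR ((expR 1 - 1) * (k%:R * b)) : R.
have c0 : 0 <= c by rewrite !mulr_ge0 ?exprn_ge0 ?expR_ge0.
have gi i j : (\int[P]_w (g i j w)%:E <= c%:E)%E.
  rewrite /g; have [ji|_] := boolP (j != i); last by rewrite integral0.
  rewrite /pair_factor integral_indep_prod//; last 3 first.
  - by move=> l; case: ifP.
  - by move=> l; case: ifP => _; [exact: expR_ge0|lra].
  - by move=> l; case: ifP.
  rewrite lee_fin.
  pose u (l i : 'I_k) : R := if l == i then expR 1 * a else 1.
  have eb : 1 <= 1 + (expR 1 - 1) * b by rewrite lerDl mulr_ge0//; lra.
  have ea : 0 <= expR 1 * a by rewrite mulr_ge0// expR_ge0.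
  (* The two factors of the pair are padded by [1 + (e - 1) b >= 1], so that this quantity occurs
     for every [l]. *)
  apply: (@le_trans _ _ (\prod_(l < k) (u l i * u l j *
      (1 + (expR 1 - 1) * b)))).
    apply: ler_prod => l _; apply/andP; split.
      by apply: pair_weight_factor_ge0; rewrite fine_ge0.
    rewrite /u; have [->|li] := eqVneq l i; rewrite /= ?hA ?hB.
      by rewrite [_ == j]eq_sym (negbTE ji) mulr1 addr0 ler_peMr.
    have [->|lj] := eqVneq l j; rewrite /= ?hA ?hB.
      by rewrite mul1r addr0 ler_peMr.
    by rewrite !mul1r addrC.
  rewrite !big_split/= prodr_const card_ord.
  have up i' : \prod_(l < k) u l i' = expR 1 * a.
    by rewrite /u -big_mkcond big_pred1_eq.
  rewrite !up /c -expr2 exprMn ler_wpM2l//.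
    by rewrite mulr_ge0// exprn_ge0// expR_ge0.
  have -> : (expR 1 - 1) * (k%:R * b) = k%:R * ((expR 1 - 1) * b) :> R by ring.
  rewrite expRM_natl; apply: lerXn2r; rewrite ?nnegrE ?expR_ge0//.
    lra.
  exact: expR_ge1Dx.
rewrite (eq_integral (fun w => (\sum_(i < k) \sum_(j < k) (g i j w)%:E)%E)); last first.
  by move=> w _; rewrite -sumEFin; apply: eq_bigr => i _; rewrite -sumEFin.
rewrite ge0_integral_sum//; last 2 first.
- by move=> i; apply: emeasurable_sum => j; apply/measurable_EFinP.
- by move=> i w _; apply: sume_ge0 => j _; rewrite lee_fin.
apply: (@le_trans _ _ (\sum_(i < k) \sum_(j < k) c%:E)%E).
  apply: lee_sum => i _; rewrite ge0_integral_sum//; last 2 first.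
  - by move=> j; apply/measurable_EFinP.
  - by move=> j w _; rewrite lee_fin.
  exact: lee_sum.
under eq_bigr do rewrite sumEFin sumr_const card_ord.
rewrite sumEFin sumr_const card_ord lee_fin.
have -> : c *+ k *+ k = k%:R * (k%:R * c) by rewrite !mulr_natl.
by rewrite /c le_eqVlt; apply/orP; left; apply/eqP; ring.
Qed.

End pair_weight_integral.

(** * Lower limits of extended real sequences *)

Section limn_einf_bounds.
Context {R : realType}.
Local Open Scope ereal_scope.
Implicit Types (u v : (\bar R)^nat) (c l : \bar R).

Lemma limn_einf_sup_inf u : limn_einf u = ereal_sup (range (einfs u)).
Proof. by rewrite limn_einf_lim; apply/cvg_lim => //; exact: cvg_einfs_sup. Qed.

Lemma le_limn_einf u c : (\forall n \near \oo, c <= u n) -> c <= limn_einf u.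
Proof.
case=> N _ Nu; rewrite limn_einf_sup_inf.
apply: (@le_trans _ _ (einfs u N)); last by apply: ereal_sup_ubound; exists N.
by apply: le_ereal_inf_tmp => _ [k /= Nk <-]; exact: Nu.
Qed.

Lemma limn_einf_le_limn u v l : (\forall n \near \oo, u n <= v n) ->
  v @ \oo --> l -> limn_einf u <= l.
Proof.
case=> N _ Nuv vl; rewrite limn_einf_lim.
rewrite -(cvg_lim _ vl)//; apply: lee_lim.
- exact: is_cvg_einfs.
- by apply/cvg_ex; exists l.
- exists N => // n Nn; apply: le_trans (Nuv _ Nn).
  by apply: ereal_inf_lbound; exists n => //=.
Qed.

Lemma measurable_limn_einf d (T : measurableType d) (f : (T -> \bar R)^nat) :
  (forall n, measurable_fun [set: T] (f n)) ->
  measurable_fun [set: T] (fun w => limn_einf (f ^~ w)).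
Proof.
move=> mf; rewrite /limn_einf.
apply: measurableT_comp => //.
apply: (@measurable_fun_limn_esup _ _ _ _ (fun n w => - f n w)) => n.
exact: measurableT_comp.
Qed.

End limn_einf_bounds.

(* The gap 1/(r+1) absorbs atoms of the Levy measure on |z| = x: the small-time
   bound only controls increments that are strictly larger than the level. The
   upper end makes cos(pi z / M) monotone on the window. *)
Definition window {R : realType} (x : R) (r : nat) : set R :=
  [set z | x + r.+1%:R^-1 < `|z| <= x + r.+1%:R].

Definition grid_increment {R : realType} {T : Type} (X : R -> T -> R) (h : R)
    (k : nat) (l : 'I_k.+1) (w : T) : R :=
  X (l.+1%:R * (h / k.+1%:R)) w - X (l%:R * (h / k.+1%:R)) w.

(** A measurable majorant of [e^N 1(N_x >= 2)]. The mesh tends to 0 first, for a fixed window,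
    because the small-time bound is asymptotic in [k]; then the windows exhaust [|z| > x]. *)
Definition pair_limit {R : realType} {T : Type} (X : R -> T -> R)
    (h eps x : R) (w : T) : \bar R :=
  limn_einf (fun r => limn_einf (fun k =>
    (pair_weight (window x r) (window eps r)
      (fun l => grid_increment X h (k := k) l w))%:E)).

Lemma measurable_window {R : realType} (x : R) r : measurable (window x r).
Proof. exact: (measurable_norm_window _ _ (@measurable_id _ R setT)). Qed.

Section pair_limit_expectation.
Context {R : realType} {d : measure_display} {T : measurableType d}.
Context (P : probability T R) (X : R -> T -> R) (m : R).
Context (nu : {measure set R -> \bar R}).
Hypotheses (hnu : levy_measure nu) (hX : levy_process P X m nu).
Context (h : R) (h0 : 0 < h).

Lemma measurable_grid_increment k (l : 'I_k.+1) :
  measurable_fun [set: T] (grid_increment X h l).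
Proof. by apply: measurable_funB; exact: levy_measurable hX _. Qed.

Lemma indep_grid_increment k :
  indep_rvs P (fun l : 'I_k.+1 => grid_increment X h l).
Proof.
case: hX => _ [_ [_ [_ [/(_ k.+1 (fun i => i%:R * (h / k.+1%:R))) H _]]]].
apply: H => [|i _]; first by rewrite mul0r.
by rewrite ltr_pM2r ?divr_gt0// ltr_nat.
Qed.

Lemma stationary_grid_increment k (l : 'I_k.+1) (B : set R) : measurable B ->
  P (grid_increment X h l @^-1` B) = P (X (h / k.+1%:R) @^-1` B).
Proof.
move=> mB; case: hX => _ [_ [_ [_ [_ [/(_ (l%:R * (h / k.+1%:R))
  (h / k.+1%:R) B) H _]]]]].
have hk : 0 <= h / k.+1%:R by rewrite divr_ge0// ltW.
have {H} := H (mulr_ge0 (ler0n _ _) hk) hk mB.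
have E (Z : T -> R) : [set w | Z w \in B] = Z @^-1` B.
  by apply/seteqP; split => w /=; rewrite inE.
rewrite !E => <-; congr (P _).
rewrite /grid_increment; apply/seteqP.
by split => w /=; rewrite -[l.+1%:R]natr1 mulrDl mul1r.
Qed.

Lemma measurable_pair_limit eps x :
  measurable_fun [set: T] (pair_limit X h eps x).
Proof.
apply: measurable_limn_einf => r; apply: measurable_limn_einf => k.
apply/measurable_EFinP; apply: measurable_pair_weight.
- exact: measurable_grid_increment.
- exact: measurable_window.
- exact: measurable_window.
Qed.

Lemma pair_limit_ge0 eps x w : (0 <= pair_limit X h eps x w)%E.
Proof.
apply: le_limn_einf; apply: nearW => r; apply: le_limn_einf; apply: nearW => k.
by rewrite lee_fin pair_weight_ge0.
Qed.

(** Fatou's lemma is applied once for each lower limit. For a fixed window the increments are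
    i.i.d., and the small-time bound controls [k a] and [k b] by [h lambda + 1/(r+1)]. *)
Lemma pair_limit_expectation eps x : 0 < eps -> eps <= x ->
  (lambda_tail nu eps < +oo)%E -> h * fine (lambda_tail nu eps) <= 1 ->
  (\int[P]_w pair_limit X h eps x w <=
   (expR 1 ^+ 2 * expR ((expR 1 - 1) * 2) *
     (h * fine (lambda_tail nu x)) ^+ 2)%:E)%E.
Proof.
move=> e0 ex epsfin hle1.
have x0 : 0 < x := lt_le_trans e0 ex.
have xfin : (lambda_tail nu x < +oo)%E.
  apply: le_lt_trans epsfin; apply: le_measure; rewrite ?inE.
  - exact: (measurable_norm_gt x (@measurable_id _ R setT)).
  - exact: (measurable_norm_gt eps (@measurable_id _ R setT)).
  - by move=> z /=; exact: le_lt_trans.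
set A := fine (lambda_tail nu x).
have A0 : 0 <= A by rewrite fine_ge0// measure_ge0.
pose C : R := expR 1 ^+ 2 * expR ((expR 1 - 1) * 2).
have C0 : 0 <= C by rewrite mulr_ge0 ?exprn_ge0 ?expR_ge0.
have e1 := @expR1_gt1 R.
have inner r : (\int[P]_w limn_einf (fun k =>
    (pair_weight (window x r) (window eps r)
      (fun l => grid_increment X h (k := k) l w))%:E) <=
    (C * (h * A + r.+1%:R^-1) ^+ 2)%:E)%E.
  apply: (le_trans (fatou _ _ _ _)) => //.
  - move=> k; apply/measurable_EFinP; apply: measurable_pair_weight.
    + exact: measurable_grid_increment.
    + exact: measurable_window.
    + exact: measurable_window.
  - by move=> k w _; rewrite lee_fin pair_weight_ge0.
  apply: limn_einf_le_limn (cvg_cst _).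
  have eta0 : 0 < r.+1%:R^-1 :> R by rewrite invr_gt0.
  have eta1 : r.+1%:R^-1 <= 1 :> R by rewrite invf_le1// ler1n.
  have yM : r.+1%:R^-1 <= r.+1%:R :> R.
    by rewrite (le_trans eta1)// ler1n.
  have bx := levy_small_time_tail hnu hX h0
    (_ : 0 < x < x + r.+1%:R^-1) (_ : x + r.+1%:R^-1 <= x + r.+1%:R) eta0 xfin.
  have {}bx := bx _ _.
  have be := levy_small_time_tail hnu hX h0
    (_ : 0 < eps < eps + r.+1%:R^-1) (_ : eps + r.+1%:R^-1 <= eps + r.+1%:R) eta0 epsfin.
  move: bx be; rewrite x0 e0 !ltrDl !eta0 !lerD2l yM => /(_ isT isT) bx /(_ isT isT) be.
  move: bx be; apply: filterS2 => k.
  pose a := fine (P (X (h / k.+1%:R) @^-1` window x r)).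
  pose b := fine (P (X (h / k.+1%:R) @^-1` window eps r)).
  rewrite -[fine (P [set w | x + _ < _ <= _])]/a.
  rewrite -[fine (P [set w | eps + _ < _ <= _])]/b => ka kb.
  have a0 : 0 <= a by rewrite fine_ge0.
  have b0 : 0 <= b by rewrite fine_ge0.
  have hA l : fine (P (grid_increment X h (k := k) l @^-1` window x r)) = a.
    by rewrite stationary_grid_increment//; exact: measurable_window.
  have hB l : fine (P (grid_increment X h (k := k) l @^-1` window eps r)) = b.
    by rewrite stationary_grid_increment//; exact: measurable_window.
  have := pair_weight_integral_le (@indep_grid_increment k)
    (@measurable_grid_increment k) (measurable_window x r)
    (measurable_window eps r) a0 b0 hA hB.
  move=> /le_trans; apply.
  rewrite lee_fin /C mulrAC; apply: ler_pM.
  + by rewrite mulr_ge0 ?exprn_ge0 ?expR_ge0.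
  + by rewrite exprn_ge0// mulr_ge0.
  (* The 2 in the constant is [1 + 1]: [h lambda_eps <= 1] and the error [1/(r+1) <= 1]. *)
  + rewrite ler_wpM2l ?exprn_ge0 ?expR_ge0// ler_expR.
    by rewrite ler_wpM2l ?subr_ge0 ?(ltW e1)// (le_trans kb)// -[2]/(1 + 1) lerD.
  + rewrite lerXn2r ?nnegrE//; first by rewrite mulr_ge0.
    by rewrite addr_ge0// ?mulr_ge0// ltW.
apply: (le_trans (fatou _ _ _ _)) => //.
- move=> r; apply: measurable_limn_einf => k.
  apply/measurable_EFinP; apply: measurable_pair_weight.
  + exact: measurable_grid_increment.
  + exact: measurable_window.
  + exact: measurable_window.
- move=> r w _; apply: le_limn_einf; apply: nearW => k.
  by rewrite lee_fin pair_weight_ge0.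
apply: (limn_einf_le_limn (v := fun r => (C * (h * A + r.+1%:R^-1) ^+ 2)%:E)).
  exact: nearW.
apply: cvg_EFin; first exact: nearW.
have hh : (h * A + r.+1%:R^-1) @[r --> \oo] --> h * A.
  by rewrite -[X in _ --> X]addr0; apply: cvgD; [exact: cvg_cst|exact: cvg_harmonic].
apply: cvgM; first exact: cvg_cst.
by under eq_fun do rewrite expr2; rewrite [(h * A) ^+ 2]expr2; exact: cvgM.
Qed.

End pair_limit_expectation.

(** * Jumps of a cadlag path *)

Lemma near_all_seq {I : eqType} {T : Type} (F : set_system T) (FF : Filter F)
    (s : seq I) (Q : I -> T -> Prop) :
  (forall i, i \in s -> \forall x \near F, Q i x) ->
  \forall x \near F, forall i, i \in s -> Q i x.
Proof.
elim: s => [_|a s IH H]; first by apply: filterE => x i; rewrite in_nil.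
have Ha := H a (mem_head _ _).
have Hs : \forall x \near F, forall i, i \in s -> Q i x.
  by apply: IH => i si; apply: H; rewrite in_cons si orbT.
move: Ha Hs; apply: filterS2 => x qa qs i.
by rewrite in_cons => /orP[/eqP ->//|]; exact: qs.
Qed.

Lemma seq_argmax {I : eqType} {R : realDomainType} (s : seq I) (g : I -> R) :
  s != [::] -> exists2 i, i \in s & forall j, j \in s -> g j <= g i.
Proof.
elim: s => // a s IH _; have [->|/IH[i si hi]] := eqVneq s [::].
  by exists a; rewrite ?mem_head// => j; rewrite inE => /eqP ->.
have [ai|ia] := leP (g a) (g i).
  exists i; first by rewrite in_cons si orbT.
  by move=> j; rewrite in_cons => /orP[/eqP ->//|]; exact: hi.
exists a; first exact: mem_head.
by move=> j; rewrite in_cons => /orP[/eqP ->//|/hi/le_trans]; apply; exact: ltW.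
Qed.

Lemma grid_index {R : realType} (h s : R) (k : nat) : 0 < h -> 0 < s <= h ->
  exists l : 'I_k.+1,
    l%:R * (h / k.+1%:R) < s <= l.+1%:R * (h / k.+1%:R).
Proof.
move=> h0 /andP[s0 sh].
have ex : exists n, s <= n%:R * (h / k.+1%:R).
  by exists k.+1; rewrite mulrCA divff ?mulr1.
case: (ex_minnP ex) => -[|n] sn nmin.
  by move: sn; rewrite mul0r leNgt s0.
have nk : (n < k.+1)%N.
  by apply: nmin; rewrite mulrCA divff ?mulr1.
exists (Ordinal nk) => /=; rewrite sn andbT ltNge; apply/negP => /nmin.
by rewrite ltnn.
Qed.

(** Of the margin [2/(r+1)], one half is the gap of the window and the other half pays for the
    distance from [v] to [j]. *)
Lemma window_near {R : realType} (z j v : R) (r : nat) : 0 < z ->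
  z + 2 * r.+1%:R^-1 < `|j| -> `|j| + 1 <= r.+1%:R -> `|v - j| < r.+1%:R^-1 ->
  window z r v.
Proof.
move=> z0 zj jr vj.
have r1 : r.+1%:R^-1 <= 1 :> R by rewrite invf_le1// ler1n.
have h1 : `|j| <= `|v| + `|v - j|.
  by have := ler_normB v (v - j); rewrite opprB addrCA subrr addr0.
have h2 : `|v| <= `|j| + `|v - j|.
  by have := ler_normD j (v - j); rewrite addrCA subrr addr0.
move: r1 zj vj jr h1 h2; rewrite /window/=; move: (r.+1%:R^-1) => i.
by move: (r.+1%:R) `|j| `|v| `|v - j| => *; apply/andP; split; lra.
Qed.

Lemma pair_weight_ge_prod {R : realType} k (A B : set R) (y : 'I_k -> R)
    (i j : 'I_k) : j != i ->
  \prod_(l < k) pair_factor A B ((l == i) || (l == j)) (y l) <=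
  pair_weight A B y.
Proof.
move=> ji.
pose t i j := if j != i then
  \prod_(l < k) pair_factor A B ((l == i) || (l == j)) (y l) else 0.
have t0 i' j' : 0 <= t i' j'.
  by rewrite /t; case: ifP => // _; apply: prodr_ge0 => l _; exact: pair_factor_ge0.
have -> : \prod_(l < k) pair_factor A B ((l == i) || (l == j)) (y l) = t i j.
  by rewrite /t ji.
rewrite -[pair_weight A B y]/(\sum_i' \sum_j' t i' j').
apply: (@le_trans _ _ (\sum_j' t i j')).
  by rewrite [leRHS](bigD1 j)// lerDl; apply: sumr_ge0.
by rewrite [leRHS](bigD1 i)// lerDl; apply: sumr_ge0 => *; apply: sumr_ge0.
Qed.

Section jumps.
Context {R : realType} {d : measure_display} {T : measurableType d}.
Context (X : R -> T -> R) (w : T).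
Hypothesis rc : forall t, 0 <= t -> X ^~ w @ t^'+ --> X t w.
Hypothesis ll : forall t, 0 < t -> cvg (X ^~ w @ t^'-).

(** Right continuity puts [X v] near [X s], and the left limit is near [X u]. The asymmetry
    [u < s <= v] matches the half-open cells of the grid. *)
Lemma jump_increment (s dl : R) : 0 < s -> 0 < dl ->
  \forall rho \near 0^'+, forall u v, u < s -> s <= v -> v - u <= rho ->
    `|X v w - X u w - jump X w s| < dl.
Proof.
move=> s0 d0; have d2 : 0 < dl / 2 by rewrite divr_gt0.
have /cvgr_dist_lt/(_ _ d2) [/= r1 r10 H1] := rc (ltW s0).
have /cvgr_dist_lt/(_ _ d2) [/= r2 r20 H2] := ll s0.
exists (Num.min r1 r2) => /=; first by rewrite lt_min r10 r20.
move=> rho /=; rewrite sub0r normrN => rmin rho0 u v us sv vu.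
rewrite gtr0_norm// lt_min in rmin; case/andP: rmin => rr1 rr2.
have hu : `|lim (X ^~ w @ s^'-) - X u w| < dl / 2.
  by apply: H2 => //=; rewrite ger0_norm; lra.
have hv : `|X s w - X v w| < dl / 2.
  move: sv; rewrite le_eqVlt => /orP[/eqP <-|sv]; first by rewrite subrr normr0.
  by apply: H1 => //=; rewrite ltr0_norm; lra.
rewrite /jump; set L := lim _ in hu *.
have -> : X v w - X u w - (X s w - L) = (L - X u w) - (X s w - X v w) by ring.
by rewrite (le_lt_trans (ler_normB _ _))//; lra.
Qed.

Lemma jump_le_oscillation (a b c e s : R) :
  (forall u, a < u < b -> `|c - X u w| < e) -> 0 < s -> a < s < b ->
  `|jump X w s| <= 2 * e.
Proof.
move=> H s0 /andP[as_ sb].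
have hs : `|c - X s w| < e by apply: H; rewrite as_ sb.
have hL : `|lim (X ^~ w @ s^'-) - c| <= e.
  apply/ler_addgt0Pr => dl d0.
  have /cvgr_dist_lt/(_ _ d0) H1 := ll s0.
  have H2 : \forall u \near s^'-, a < u by exact: nbhs_left_gt.
  have H3 : \forall u \near s^'-, u < s by exact: nbhs_left_lt.
  have [u [hu [au us]]] : exists u,
      `|lim (X ^~ w @ s^'-) - X u w| < dl /\ a < u /\ u < s.
    by apply: (@filter_ex _ s^'-); exact: filterI H1 (filterI H2 H3).
  have := H u; rewrite au (lt_trans us sb) => /(_ isT) cu.
  set L := lim _ in hu *.
  have -> : L - c = (L - X u w) - (c - X u w) by ring.
  by rewrite (le_trans (ler_normB _ _))//; lra.
rewrite /jump; set L := lim _ in hL *.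
have -> : X s w - L = - (c - X s w) - (L - c) by ring.
by rewrite (le_trans (ler_normB _ _))// normrN; lra.
Qed.

(** On each side of [t] the path stays close to its one-sided limit, hence oscillates little. The
    case [t = 0] has only a right side. *)
Lemma jump_locally_small (t e : R) : 0 <= t -> 0 < e ->
  exists2 rho, 0 < rho & forall s, 0 < s -> s != t -> `|t - s| < rho ->
    `|jump X w s| <= e.
Proof.
move=> t0 e0; have e2 : 0 < e / 2 by rewrite divr_gt0.
have ee : 2 * (e / 2) = e by field.
have /cvgr_dist_lt/(_ _ e2) [/= r1 r10 H1] := rc t0.
have right s : 0 < s -> t < s -> `|t - s| < r1 -> `|jump X w s| <= e.
  move=> s0 ts sr; rewrite -ee.
  apply: (@jump_le_oscillation t (t + r1) (X t w)) => //; last first.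
    by rewrite ts /=; move: sr; rewrite ltr0_norm; lra.
  move=> u /andP[tu ur]; apply: H1 => //=; rewrite ltr0_norm; lra.
move: t0; rewrite le_eqVlt => /orP[/eqP t0|t0].
  exists r1 => // s s0 st sr; apply: right => //; by rewrite -t0.
have /cvgr_dist_lt/(_ _ e2) [/= r2 r20 H2] := ll t0.
exists (Num.min r1 r2); first by rewrite lt_min r10 r20.
move=> s s0 st; rewrite lt_min => /andP[sr1 sr2].
move: st; rewrite neq_lt => /orP[st|st]; last exact: right.
rewrite -ee; apply: (@jump_le_oscillation (t - r2) t (lim (X ^~ w @ t^'-))) => //.
  by move=> u /andP[ur ut]; apply: H2 => //=; rewrite gtr0_norm; lra.
by rewrite st andbT; move: sr2; rewrite gtr0_norm; lra.
Qed.

(** An infinite bounded set has a limit point, near which all other jumps are small. Finiteness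
    makes the sum in [Xeps] a genuine one rather than a default value. *)
Lemma finite_large_jumps (h e : R) : 0 < e ->
  finite_set [set s | 0 < s <= h /\ e < `|jump X w s|].
Proof.
move=> e0; set E := [set s | _]; apply: contrapT => infE.
have bndE : bounded_set E.
  exists h; split; first exact: num_real.
  move=> M hM s [/andP[s0 sh] _] /=; rewrite gtr0_norm//.
  by rewrite (le_trans sh)// ltW.
have [t /limit_point_infinite_setP tE] := infinite_bounded_limit_point_nonempty infE bndE.
have [t0|t0] := ltP t 0.
  apply: (tE (ball t (- t))); first by apply: nbhsx_ballx; lra.
  rewrite (_ : _ `&` _ = set0)//; apply/seteqP; split => // s [/=].
  by rewrite /ball/= => ts [/andP[s0 _] _]; move: ts; rewrite ltr0_norm; lra.
have [rho rho0 H] := jump_locally_small t0 e0.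
apply: (tE (ball t rho)); first exact: nbhsx_ballx.
apply: (@sub_finite_set _ _ [set t]) => // s [/= ts [/andP[s0 sh] es]].
apply/eqP; apply: contraTT es => st; rewrite -leNgt; exact: H.
Qed.

(** On a fine grid the times in [q] lie in distinct cells whose increments approximate the jumps,
    hence fall in the windows once [r] is large. The product attached to the cells of [s1] and [s2]
    then has a factor [e] at each cell of [q] and factors at least 1 elsewhere. *)
Lemma pair_limit_ge (h eps x : R) (q : seq R) (s1 s2 : R) : 0 < h ->
  0 < eps -> eps <= x -> uniq q ->
  (forall s, s \in q -> 0 < s <= h) ->
  (forall s, s \in q -> eps < `|jump X w s|) ->
  s1 \in q -> s2 \in q -> s1 != s2 ->
  x < `|jump X w s1| -> x < `|jump X w s2| ->
  ((expR 1 ^+ size q)%:E <= pair_limit X h eps x w)%E.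
Proof.
move=> h0 eps0 epsx uq qh qeps q1 q2 s12 x1 x2.
have e1 := @expR1_gt1 R.
have harm (a b : R) : a < b -> \forall r \near \oo, a + 2 * r.+1%:R^-1 < b.
  move=> ab; have b0 : 0 < (b - a) / 2 by rewrite divr_gt0// subr_gt0.
  have /cvgr_dist_lt/(_ _ b0) := @cvg_harmonic R.
  apply: filterS => r; rewrite sub0r normrN ger0_norm ?harmonic_ge0//.
  move=> hr; have {hr} : r.+1%:R^-1 < (b - a) / 2 := hr.
  by move: (r.+1%:R^-1) => i; lra.
have large (s : R) : \forall r \near \oo, `|jump X w s| + 1 <= r.+1%:R.
  near=> r; rewrite -natr1 lerD2r; near: r; exact: nbhs_infty_ger.
apply: le_limn_einf.
have hr1 : \forall r \near \oo, forall s, s \in q ->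
    eps + 2 * r.+1%:R^-1 < `|jump X w s|.
  by apply: near_all_seq => s sq; apply: harm; exact: qeps.
have hr2 : \forall r \near \oo, forall s, s \in q ->
    `|jump X w s| + 1 <= r.+1%:R.
  by apply: near_all_seq => s sq; exact: large.
have hx1 := harm _ _ x1; have hx2 := harm _ _ x2.
near=> r; apply: le_limn_einf.
have r0 : 0 < r.+1%:R^-1 :> R by rewrite invr_gt0.
have r1 : r.+1%:R^-1 <= 1 :> R by rewrite invf_le1// ler1n.
have Hr1 : forall s, s \in q -> eps + 2 * r.+1%:R^-1 < `|jump X w s|.
  by near: r.
have Hr2 : forall s, s \in q -> `|jump X w s| + 1 <= r.+1%:R by near: r.
have Hx1 : x + 2 * r.+1%:R^-1 < `|jump X w s1| by near: r.
have Hx2 : x + 2 * r.+1%:R^-1 < `|jump X w s2| by near: r.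
have inc : \forall rho \near 0^'+, forall s, s \in q ->
    forall u v, u < s -> s <= v -> v - u <= rho ->
    `|X v w - X u w - jump X w s| < r.+1%:R^-1.
  apply: near_all_seq => s sq; apply: jump_increment => //.
  by have /andP[] := qh s sq.
have sep : \forall rho \near 0^'+, forall s, s \in q -> forall t, t \in q ->
    s != t -> rho < `|s - t|.
  apply: near_all_seq => s sq; apply: near_all_seq => t tq.
  have [->|st] := eqVneq s t; first exact: nearW.
  have st0 : 0 < `|s - t| by rewrite normr_gt0 subr_eq0.
  by near=> rho => _; near: rho; exact: nbhs_right_lt.
have mesh : h / k.+1%:R @[k --> \oo] --> 0^'+.
  have c0 : h / k.+1%:R @[k --> \oo] --> 0.
    rewrite -[X in _ --> X](mulr0 h); apply: cvgM; first exact: cvg_cst.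
    exact: cvg_harmonic.
  move=> A [/= e e0 HA].
  have /cvgr_dist_lt/(_ _ e0) := c0.
  apply: filterS => k hk; apply: HA => //=.
  by rewrite divr_gt0.
near=> k; rewrite lee_fin.
have Hinc : forall s, s \in q -> forall u v, u < s -> s <= v ->
    v - u <= h / k.+1%:R -> `|X v w - X u w - jump X w s| < r.+1%:R^-1.
  by near: k; exact: (mesh _ inc).
have Hsep : forall s, s \in q -> forall t, t \in q ->
    s != t -> h / k.+1%:R < `|s - t|.
  by near: k; exact: (mesh _ sep).
pose y (l : 'I_k.+1) := grid_increment X h l w.
(* [idx s] is the cell containing [s]; for [s] outside [q] it is an arbitrary index. *)
have /choice[idx hidx] : forall s, exists l : 'I_k.+1, s \in q ->
    l%:R * (h / k.+1%:R) < s <= l.+1%:R * (h / k.+1%:R).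
  move=> s; have [sq|] := boolP (s \in q); last by exists ord0.
  by have [l hl] := grid_index k h0 (qh s sq); exists l.
have hy s : s \in q -> `|y (idx s) - jump X w s| < r.+1%:R^-1.
  move=> sq; have /andP[l1 l2] := hidx s sq.
  apply: Hinc => //; rewrite -[(idx s).+1%:R]natr1 mulrDl mul1r addrC addrA.
  by rewrite addNr add0r.
have hwin z s : s \in q -> eps <= z -> z + 2 * r.+1%:R^-1 < `|jump X w s| ->
    window z r (y (idx s)).
  move=> sq ez zj; apply: (window_near _ zj (Hr2 s sq) (hy s sq)).
  exact: lt_le_trans ez.
have idx_inj : {in q &, injective idx}.
  move=> s t sq tq st; apply/eqP; apply/negPn/negP => /(Hsep s sq t tq).
  have /andP[] := hidx s sq; have /andP[] := hidx t tq; rewrite -st.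
  rewrite -[(idx s).+1%:R]natr1 mulrDl mul1r => a1 a2 a3 a4.
  rewrite ltNge ler_norml => /negP; apply; move: a1 a2 a3 a4.
  set c := h / k.+1%:R; set g := _%:R * c.
  by clear; move=> *; apply/andP; split; lra.
have i12 : idx s2 != idx s1.
  by apply: contra s12 => /eqP/(idx_inj _ _ q2 q1)/esym/eqP.
have -> : expR 1 ^+ size q = \prod_(l < k.+1) (if l \in map idx q then expR 1 else 1) :> R.
  rewrite -big_mkcond prodr_const (card_uniqP _) ?size_map//.
  by rewrite map_inj_in_uniq.
apply: le_trans (pair_weight_ge_prod _ _ y i12).
apply: ler_prod => l _; apply/andP; split; first by case: ifP; rewrite ?expR_ge0.
rewrite -/(y l) /pair_factor; case: ifPn => [/mapP[s sq ->]|lI]; last first.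
  have hq s : s \in q -> l == idx s = false.
    by move=> sq; apply: contraNF lI => /eqP ->; exact: map_f.
  by rewrite !hq//= lerDr mulr_ge0//; lra.
have [->|n1] := eqVneq (idx s) (idx s1).
  by rewrite /= indicE mem_set ?mulr1 ?addr0//; exact: hwin.
have [->|n2] := eqVneq (idx s) (idx s2).
  by rewrite /= indicE mem_set ?mulr1 ?addr0//; exact: hwin.
by rewrite /= indicE mem_set ?mulr1 ?subrK//; apply: hwin => //; exact: Hr1.
Unshelve. all: by end_near. Qed.

End jumps.

(** * Moments of the overshoot *)

(* No measurability is required: the integral of a nonnegative function is a
   supremum over simple functions below it. The overshoot is not shown to be
   measurable. *)
Lemma le_integral_ge0 {R : realType} d (T : measurableType d)
    (mu : {measure set T -> \bar R}) (f g : T -> \bar R) :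
  (forall x, 0 <= f x)%E -> (forall x, f x <= g x)%E ->
  (\int[mu]_x f x <= \int[mu]_x g x)%E.
Proof.
move=> f0 fg; have g0 x : (0 <= g x)%E by exact: le_trans (f0 x) (fg x).
rewrite !ge0_integralTE//; apply: ereal_sup_le => _ [u uf <-].
exists u => // x.
exact: le_trans (uf x) (fg x).
Qed.

Section overshoot.
Context {R : realType} {d : measure_display} {T : measurableType d}.
Context (X : R -> T -> R) (w : T) (h eps : R) (q : seq R).
Hypotheses (h0 : 0 < h) (uq : uniq q).
Hypothesis qE : forall s, s \in q <-> (0 < s <= h /\ eps < `|jump X w s|).

Let J := jump X w.

Definition overshoot : R :=
  sup [set Xeps X eps t w | t in [set t | 0 <= t <= h]] -
  Num.max (Xeps X eps h w) 0.

Lemma Xeps_sum (t : R) : t <= h ->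
  Xeps X eps t w = \sum_(s <- q) (if s <= t then J s else 0).
Proof.
move=> th; rewrite /Xeps (_ : [set s | _] = [set` q] `&` [set s | s <= t]).
  rewrite fsbig_mkcondr -fsbig_seq//; apply: eq_bigr => s _.
  have [st|st] := boolP (s <= t); first by rewrite mem_set.
  by rewrite memNset//=; apply/negP.
apply/seteqP; split => s /=.
  by move=> [/andP[s0 st] es]; split => //; apply/qE; rewrite s0 (le_trans st th).
by move=> [/qE[/andP[s0 _] es] st]; split => //; rewrite s0.
Qed.

(** If [t < k], the partial sum does not yet contain the jump at [k]. If [k <= t], it is the total
    minus the jumps after [t], none of which is at [k]. Either way any one chosen jump can be
    spared. *)
Lemma le_overshoot_bound (k t : R) : t <= h ->
  Xeps X eps t w <=
  \sum_(s <- q | s != k) `|J s| + Num.max (Xeps X eps h w) 0.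
Proof.
move=> th; rewrite big_mkcond/=.
have [tk|kt] := ltP t k.
  apply: (@le_trans _ _ (\sum_(s <- q) (if s != k then `|J s| else 0))).
    rewrite Xeps_sum// ler_sum// => s _; have [->|sk] := eqVneq s k.
      by rewrite (leNgt k t) tk.
    by case: ifP => // _; rewrite ler_norm.
  by rewrite lerDl le_max lexx orbT.
apply: (@le_trans _ _ (\sum_(s <- q) (if s != k then `|J s| else 0) +
    Xeps X eps h w)); last by rewrite lerD2l le_max lexx.
rewrite !Xeps_sum// -big_split/= big_seq [leRHS]big_seq ler_sum// => s.
move=> /qE[/andP[_ ->] _].
have [st|ts] := leP s t; first by rewrite lerDr; case: ifP.
have -> : s != k by rewrite gt_eqF// (le_lt_trans kt).
by rewrite -lerBlDr sub0r -normrN ler_norm.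
Qed.

Lemma overshoot_le (k : R) : overshoot <= \sum_(s <- q | s != k) `|J s|.
Proof.
rewrite /overshoot lerBlDr; apply: ge_sup.
  by exists (Xeps X eps 0 w); exists 0 => //=; rewrite lexx ltW.
by move=> _ [t /= /andP[_ th] <-]; exact: le_overshoot_bound.
Qed.

Lemma overshoot_ge0 : 0 <= overshoot.
Proof.
have ub : has_ubound [set Xeps X eps t w | t in [set t | 0 <= t <= h]].
  exists (\sum_(s <- q | s != 0) `|J s| + Num.max (Xeps X eps h w) 0).
  by move=> _ [t /= /andP[_ th] <-]; exact: le_overshoot_bound.
rewrite /overshoot subr_ge0 ge_max; apply/andP; split.
  by apply: ub_le_sup => //; exists h => //=; rewrite lexx ltW.
apply: ub_le_sup => //; exists 0; first by rewrite /= lexx ltW.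
rewrite Xeps_sum ?ltW// big1_seq// => s /andP[_ /qE[/andP[s0 _] _]].
by rewrite leNgt s0.
Qed.

(** Spare the largest jump and bound every remaining one by the largest among them. Positivity of
    the overshoot forces at least two jumps. *)
Lemma overshoot_second_largest : 0 < overshoot ->
  exists s1 s2, [/\ s1 \in q, s2 \in q, s1 != s2,
    `|J s2| <= `|J s1| & overshoot <= (size q)%:R * `|J s2|].
Proof.
move=> o0.
have qn : q != [::].
  by apply: contraTneq o0 => q0; rewrite -leNgt (le_trans (overshoot_le 0))// q0 big_nil.
have [s1 q1 max1] := seq_argmax (fun s => `|J s|) qn.
pose q' := [seq s <- q | s != s1].
have oq' : overshoot <= \sum_(s <- q') `|J s|.
  by rewrite big_filter; exact: overshoot_le.
have qn' : q' != [::].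
  by apply: contraTneq o0 => q0; rewrite -leNgt (le_trans oq')// q0 big_nil.
have [s2 q2 max2] := seq_argmax (fun s => `|J s|) qn'.
move: (q2); rewrite mem_filter => /andP[s21 q2'].
exists s1, s2; split => //; [by rewrite eq_sym|exact: max1|].
apply: (le_trans oq'); apply: (@le_trans _ _ (\sum_(s <- q') `|J s2|)).
  by rewrite big_seq [leRHS]big_seq ler_sum// => s /max2.
rewrite big_const_seq iter_addr_0 count_predT -[X in X <= _]mulr_natl.
by rewrite ler_wpM2r// ler_nat size_filter count_size.
Qed.

End overshoot.

(** Raise [N/p <= exp(N/p)] to the power [p]. *)
Lemma natr_powR_le {R : realType} (p : R) (N : nat) : 0 < p ->
  N%:R `^ p <= p `^ p * expR 1 ^+ N.
Proof.
move=> p0; have Np : 0 <= N%:R / p by rewrite divr_ge0// ltW.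
have -> : N%:R = p * (N%:R / p) :> R by rewrite mulrCA divff ?mulr1// gt_eqF.
rewrite powRM ?(ltW p0)// ler_wpM2l ?powR_ge0//.
have -> : expR 1 ^+ N = expR (N%:R / p) `^ p :> R.
  by rewrite -expRM divfK ?gt_eqF// -expRM_natr mul1r.
apply: ge0_ler_powR; rewrite ?nnegrE ?expR_ge0 ?(ltW p0)//.
by apply: le_trans (expR_ge1Dx _); rewrite lerDr.
Qed.

Lemma dyadic_level {R : realType} (eps M : R) : 0 < eps -> eps < M ->
  exists j : nat, 2 ^+ j * eps < M <= 2 ^+ j.+1 * eps.
Proof.
move=> e0 eM.
have ex : exists j, M <= 2 ^+ j * eps.
  exists (Num.truncn (M / eps)).+1; rewrite -ler_pdivrMr//.
  apply: (le_trans (ltW (truncnS_gt _))); rewrite -natrX ler_nat ltnW//.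
  exact: ltn_expl.
case: (ex_minnP ex) => -[|j] Mj jmin.
  by move: Mj; rewrite expr0 mul1r leNgt eM.
exists j; rewrite Mj andbT ltNge; apply/negP => /jmin.
by rewrite ltnn.
Qed.

Section overshoot_moment.
Context {R : realType} {d : measure_display} {T : measurableType d}.
Context (X : R -> T -> R) (w : T).
Hypothesis rc : forall t, 0 <= t -> X ^~ w @ t^'+ --> X t w.
Hypothesis ll : forall t, 0 < t -> cvg (X ^~ w @ t^'-).

(** The single term whose dyadic level [j] is that of the second largest jump already dominates; the
    others are nonnegative. *)
Lemma overshoot_powR_le (h eps p : R) : 0 < h -> 0 < eps -> 1 < p ->
  ((overshoot X w h eps `^ p)%:E <=
   \sum_(0 <= j <oo) ((p `^ p * (2 ^+ j.+1 * eps) `^ p)%:E *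
     pair_limit X h eps (2 ^+ j * eps) w))%E.
Proof.
move=> h0 e0 p1; have p0 : 0 < p by lra.
have fS := finite_large_jumps rc ll h e0.
have /finite_seqP[q0 q0E] := fS.
pose q := undup q0.
have uq : uniq q by exact: undup_uniq.
have qE s : s \in q <-> (0 < s <= h /\ eps < `|jump X w s|).
  by rewrite mem_undup; move: q0E => /seteqP[H1 H2]; split => [/H2//|/H1].
have term0 j : (0 <= (p `^ p * (2 ^+ j.+1 * eps) `^ p)%:E *
     pair_limit X h eps (2 ^+ j * eps) w)%E.
  by rewrite mule_ge0 ?pair_limit_ge0// lee_fin mulr_ge0// powR_ge0.
have := overshoot_ge0 h0 uq qE; rewrite le_eqVlt => /orP[/eqP <-|o0].
  by rewrite powR0 ?gt_eqF// nneseries_ge0.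
have [s1 [s2 [q1 q2 s12 J21 oJ]]] := overshoot_second_largest h0 uq qE o0.
have [_ eJ2] := (qE s2).1 q2.
have [j /andP[jl ju]] := dyadic_level e0 eJ2.
have le1 : ((expR 1 ^+ size q)%:E <= pair_limit X h eps (2 ^+ j * eps) w)%E.
  apply: (pair_limit_ge rc ll h0 e0 _ uq _ _ q1 q2 s12).
  - by rewrite ler_peMl ?(ltW e0)// exprn_ege1// ler1n.
  - by move=> s /qE[].
  - by move=> s /qE[].
  - exact: lt_le_trans J21.
  - exact: jl.
apply: (@le_trans _ _ ((p `^ p * (2 ^+ j.+1 * eps) `^ p)%:E *
     pair_limit X h eps (2 ^+ j * eps) w)%E); last first.
  apply: le_trans (nneseries_lim_ge j.+1 (fun n _ _ => term0 n)).
  rewrite big_nat_recr//= leeDr//.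
  by apply: sume_ge0.
apply: (@le_trans _ _ ((p `^ p * (2 ^+ j.+1 * eps) `^ p)%:E *
     (expR 1 ^+ size q)%:E)%E); last first.
  by apply: lee_wpmul2l => //; rewrite lee_fin mulr_ge0// powR_ge0.
rewrite -EFinM lee_fin mulrAC.
have e20 : 0 <= 2 ^+ j.+1 * eps by rewrite mulr_ge0 ?exprn_ge0// ltW.
apply: (@le_trans _ _ ((size q)%:R `^ p * (2 ^+ j.+1 * eps) `^ p)).
  rewrite -powRM//; apply: ge0_ler_powR; rewrite ?nnegrE ?(ltW p0) ?(ltW o0)//.
    by rewrite mulr_ge0.
  by apply: (le_trans oJ); rewrite ler_wpM2l.
by rewrite ler_wpM2r ?powR_ge0// natr_powR_le.
Qed.

End overshoot_moment.

(** * Comparison of a dyadic sum with the integral [L_eps] *)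

Section dyadic_sum.
Context {R : realType} (nu : {measure set R -> \bar R}) (eps p : R).
Hypotheses (e0 : 0 < eps) (p1 : 1 < p).
Hypothesis (fin : (lambda_tail nu eps < +oo)%E).

Let lam x := fine (lambda_tail nu x).

Lemma lambda_tail_le x y : x <= y -> (lambda_tail nu y <= lambda_tail nu x)%E.
Proof.
move=> xy; apply: le_measure; rewrite ?inE.
- exact: (measurable_norm_gt y (@measurable_id _ R setT)).
- exact: (measurable_norm_gt x (@measurable_id _ R setT)).
- by move=> z /=; exact: le_lt_trans.
Qed.

Lemma lambda_tail_fin x : eps <= x -> lambda_tail nu x = (lam x)%:E.
Proof.
move=> ex; rewrite fineK// ge0_fin_numE ?measure_ge0//.
exact: le_lt_trans (lambda_tail_le ex) fin.
Qed.

Lemma fine_lambda_tail_le x y : eps <= x -> x <= y -> lam y <= lam x.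
Proof.
move=> ex xy; rewrite -lee_fin -!lambda_tail_fin ?(le_trans ex)//.
exact: lambda_tail_le.
Qed.

Lemma fine_lambda_tail_ge0 x : 0 <= lam x.
Proof. by rewrite fine_ge0// measure_ge0. Qed.

Let p0 : 0 < p.
Proof. exact: lt_trans ltr01 p1. Qed.

Let I j : set R := `]2 ^+ j * eps, 2 ^+ j.+1 * eps]%classic.

Let pow2_mono (i j : nat) : (i <= j)%N -> 2 ^+ i * eps <= 2 ^+ j * eps.
Proof. by move=> ij; rewrite ler_pM2r// ler_eXn2l// ltr1n. Qed.

Lemma dyadic_intervals_trivIset : trivIset [set: nat] I.
Proof.
have half i j : (i < j)%N -> I i `&` I j = set0.
  move=> ij; apply/seteqP; split => // x []; rewrite /I/= !in_itv/=.
  move=> /andP[_ xi] /andP[jx _].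
  by have := lt_le_trans jx xi; rewrite ltNge pow2_mono.
apply/trivIsetP => i j _ _; rewrite neq_ltn => /orP[/half//|/half].
by rewrite setIC.
Qed.

Lemma dyadic_intervals_cover : [set x : R | eps < x] = \bigcup_j I j.
Proof.
apply/seteqP; split => x /=.
  by move=> /(dyadic_level e0)[j xj]; exists j => //; rewrite /I/= in_itv.
move=> [j _]; rewrite /I/= in_itv/= => /andP[jx _]; apply: le_lt_trans jx.
by rewrite -[leLHS]mul1r -(expr0 2) pow2_mono.
Qed.

(** On []a, 2a]] with [a = 2^j eps] the integrand is at least [a^(p-1) lambda_(2a)^2], and the
    interval has length [a]. *)
Lemma le_L_eps :
  (p%:E * \sum_(0 <= j <oo) (((2 ^+ j * eps) `^ p * lam (2 ^+ j.+1 * eps) ^+ 2)%:E)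
    <= L_eps nu eps p)%E.
Proof.
rewrite /L_eps lee_wpmul2l//; first by rewrite lee_fin ltW.
(* The maximum with [eps] keeps the tail finite on the whole line, so that measurability follows
   from monotonicity; for [x > eps] nothing changes. *)
pose g x := ((x `^ (p - 1) * lam (Num.max x eps) ^+ 2)%:E)%E.
have mg : measurable_fun [set: R] g.
  apply/measurable_EFinP; apply: measurable_funM.
    exact: measurable_powR.
  apply: measurable_funX; apply: nonincreasing_measurable => // x y xy.
  apply: fine_lambda_tail_le; first by rewrite le_max lexx orbT.
  by rewrite ge_max !le_max xy lexx !orbT.
rewrite (_ : (\int[lebesgue_measure]_(x in [set x | _]) _)%E =
    (\int[lebesgue_measure]_(x in [set x | (eps < x)%R]) g x)%E); last first.
  apply: eq_integral => x; rewrite inE /= => ex.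
  by rewrite /g lambda_tail_fin ?(ltW ex)// max_l ?(ltW ex)// -EFin_expe -EFinM.
rewrite dyadic_intervals_cover ge0_integral_bigcup//; last 4 first.
- by move=> j; exact: measurable_itv.
- exact: measurable_funTS.
- by move=> x _; rewrite lee_fin mulr_ge0 ?powR_ge0// sqr_ge0.
- exact: dyadic_intervals_trivIset.
apply: lee_nneseries => [j _ _|j _].
  by rewrite lee_fin mulr_ge0 ?powR_ge0// sqr_ge0.
have a0 : 0 < 2 ^+ j * eps by rewrite mulr_gt0// exprn_gt0.
set a := 2 ^+ j * eps in a0 *.
have aS : 2 ^+ j.+1 * eps = a + a by rewrite exprS -mulrA -/a; ring.
pose c := a `^ (p - 1) * lam (2 ^+ j.+1 * eps) ^+ 2.
have c0 : 0 <= c by rewrite mulr_ge0 ?powR_ge0// sqr_ge0.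
apply: (@le_trans _ _ (\int[lebesgue_measure]_(x in I j) (cst c%:E x))%E).
  rewrite integral_cst; last exact: measurable_itv.
  have mI : lebesgue_measure (I j) = a%:E.
    by rewrite /I lebesgue_measure_itv/= lte_fin aS -/a ltrDr a0 -EFinB addrK.
  rewrite (_ : (c%:E * _)%E = (c%:E * a%:E)%E); last first.
    by congr (_ * _)%E; exact: mI.
  rewrite -EFinM lee_fin.
  have -> : a `^ p = a `^ (p - 1) * a.
    rewrite -[X in _ = _ * X](powRr1 (ltW a0)) -powRD ?subrK//.
    by rewrite gt_eqF ?implybT.
  by rewrite /c mulrAC.
apply: ge0_le_integral => //.
- exact: measurable_itv.
- exact: measurable_funTS.
- move=> x; rewrite /I/= in_itv/= => /andP[ax xb]; rewrite lee_fin /c.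
  have ea : eps <= a by rewrite -[leLHS]mul1r -(expr0 2) pow2_mono.
  have ex : eps <= x by rewrite (le_trans ea)// ltW.
  rewrite (max_l ex); apply: ler_pM; rewrite ?powR_ge0 ?sqr_ge0//.
    apply: ge0_ler_powR; [|by rewrite nnegrE ltW| |exact: ltW].
      by rewrite subr_ge0 ltW.
    by rewrite nnegrE (le_trans (ltW e0)).
  by rewrite lerXn2r ?nnegrE ?fine_lambda_tail_ge0// fine_lambda_tail_le.
Qed.

(** The term [j = 0] gives the summand with [eps^p]. In the term [j + 1],
    [(2^(j+2) eps)^p = 4^p (2^j eps)^p] turns the upper sum into the lower sum bounded by [L_eps];
    its prefactor [p] is dropped as [p >= 1]. *)
Lemma dyadic_sum_le :
  (\sum_(0 <= j <oo) (((2 ^+ j.+1 * eps) `^ p * lam (2 ^+ j * eps) ^+ 2)%:E)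
    <= (4 `^ p)%:E * ((eps `^ p * lam eps ^+ 2)%:E + L_eps nu eps p))%E.
Proof.
have t0 j : (0 <= ((2 ^+ j.+1 * eps) `^ p * lam (2 ^+ j * eps) ^+ 2)%:E)%E.
  by rewrite lee_fin mulr_ge0 ?powR_ge0// sqr_ge0.
have u0 j : (0 <= ((2 ^+ j * eps) `^ p * lam (2 ^+ j.+1 * eps) ^+ 2)%:E)%E.
  by rewrite lee_fin mulr_ge0 ?powR_ge0// sqr_ge0.
have four0 : 0 <= (4 : R) `^ p by rewrite powR_ge0.
rewrite nneseries_recl// ge0_muleDr; last 2 first.
- by rewrite lee_fin mulr_ge0 ?powR_ge0// sqr_ge0.
- by apply: le_trans le_L_eps; rewrite mule_ge0 ?nneseries_ge0// lee_fin ltW.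
rewrite expr0 mul1r expr1 leeD//.
  rewrite -EFinM lee_fin powRM ?(ltW e0)// -!mulrA.
  rewrite ler_wpM2r//; first by rewrite mulr_ge0 ?powR_ge0// sqr_ge0.
  by apply: ge0_ler_powR; rewrite ?nnegrE ?ler_nat ?(ltW p0).
apply: (@le_trans _ _ ((4 `^ p)%:E * \sum_(0 <= j <oo)
    (((2 ^+ j * eps) `^ p * lam (2 ^+ j.+1 * eps) ^+ 2)%:E))%E).
  rewrite -(nneseries_addn 1)// -nneseriesZl//.
  apply: lee_nneseries => // j _; rewrite addn1 -EFinM lee_fin [leRHS]mulrA -powRM//.
    by rewrite -[4]/(2 * 2)%:R natrM !exprS !mulrA.
  by rewrite mulr_ge0 ?exprn_ge0// ltW.
rewrite lee_wpmul2l ?lee_fin//; apply: le_trans le_L_eps.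
by rewrite lee_pemull ?nneseries_ge0// lee_fin ltW.
Qed.

End dyadic_sum.

(** * Assembly of the moment bound *)

Unset Implicit Arguments.

Theorem mainTheorem6 (R : realType) (p : R) (hp : 1 < p) :
  exists K : R,
  forall (d : measure_display) (T : measurableType d) (P : probability T R)
    (X : R -> T -> R) (m : R) (nu : {measure set R -> \bar R}),
  levy_measure nu -> levy_process P X m nu ->
  forall (eps : R) (n : nat), 0 < eps < 1 -> (1 <= n)%N ->
  (0 < lambda_tail nu eps)%E -> (lambda_tail nu eps <= n%:R%:E)%E ->
  let lam := fine (lambda_tail nu eps) in
  (\int[P]_w
     ((sup [set Xeps X eps t w | t in [set t | 0 <= t <= n%:R^-1]]
       - Num.max (Xeps X eps n%:R^-1 w) 0) `^ p)%R%:E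
   <= K%:E * ((powR eps p)%:E + L_eps nu eps p * ((lam ^+ 2)^-1)%:E)
        * (lam ^+ 2 / n%:R ^+ 2)%:E)%E.
Proof.
pose C : R := expR 1 ^+ 2 * expR ((expR 1 - 1) * 2).
have C0 : 0 <= C by rewrite mulr_ge0 ?exprn_ge0 ?expR_ge0.
(* [p^p] comes from [N^p <= p^p e^N], [C] from the expectation of [pair_limit], and [4^p] from the
   dyadic sum. *)
pose K : R := p `^ p * C * 4 `^ p.
have K0 : 0 < K.
  have p0 : 0 < p by lra.
  by rewrite !mulr_gt0 ?exprn_gt0 ?expR_gt0 ?powR_gt0.
exists K => d T P X m nu hnu hX eps n /andP[e0 _] n1 lam0 lamn.
cbv zeta; set lam := fine (lambda_tail nu eps).
have n0 : 0 < n%:R :> R by rewrite ltr0n.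
set h : R := n%:R^-1.
have h0 : 0 < h by rewrite invr_gt0.
have lfin : (lambda_tail nu eps < +oo)%E by rewrite (le_lt_trans lamn)// ltry.
have lamE : lambda_tail nu eps = lam%:E by exact: (lambda_tail_fin lfin (lexx eps)).
have lam_gt0 : 0 < lam by rewrite -lte_fin -lamE.
have hl : h * lam <= 1.
  by rewrite mulrC ler_pdivrMr// mul1r -lee_fin -lamE.
have rc w t : 0 <= t -> X ^~ w @ t^'+ --> X t w.
  by move=> t0; case: hX => _ [_ [H _]]; exact: H.
have ll w t : 0 < t -> cvg (X ^~ w @ t^'-).
  by move=> t0; case: hX => _ [_ [_ [H _]]]; exact: H.
pose c j := p `^ p * (2 ^+ j.+1 * eps) `^ p.
have c0 j : 0 <= c j by rewrite mulr_ge0 ?powR_ge0.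
pose H j w := ((c j)%:E * pair_limit X h eps (2 ^+ j * eps) w)%E.
have mpl j := measurable_pair_limit hX h eps (2 ^+ j * eps).
have mH j : measurable_fun [set: T] (H j) by exact: measurable_funeM.
have H0 j w : (0 <= H j w)%E by rewrite mule_ge0 ?lee_fin ?pair_limit_ge0.
apply: (@le_trans _ _ (\int[P]_w (\sum_(0 <= j <oo) H j w))%E).
  apply: le_integral_ge0 => w; first by rewrite lee_fin powR_ge0.
  exact: (overshoot_powR_le (rc w) (ll w) h0 e0 hp).
rewrite integral_nneseries//.
apply: (@le_trans _ _ (\sum_(0 <= j <oo) ((p `^ p * C * h ^+ 2)%:E *
    ((2 ^+ j.+1 * eps) `^ p * fine (lambda_tail nu (2 ^+ j * eps)) ^+ 2)%:E))%E).
  apply: lee_nneseries => [j _ _|j _]; first exact: integral_ge0.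
  rewrite /H ge0_integralZl//; last by rewrite lee_fin.
    have ej : eps <= 2 ^+ j * eps by rewrite ler_peMl ?(ltW e0)// exprn_ege1// ler1n.
    have := pair_limit_expectation hnu hX h0 e0 ej lfin hl.
    move=> /(lee_wpmul2l (_ : (0 <= (c j)%:E)%E)) => /(_ (c0 j)) /le_trans; apply.
    rewrite -!EFinM lee_fin le_eqVlt; apply/orP; left; apply/eqP.
    by rewrite /c -/C; ring.
  by move=> w _; exact: pair_limit_ge0.
rewrite nneseriesZl; last by move=> j _; rewrite lee_fin mulr_ge0 ?powR_ge0// sqr_ge0.
have k0 : 0 <= p `^ p * C * h ^+ 2.
  exact: mulr_ge0 (mulr_ge0 (powR_ge0 _ _) C0) (sqr_ge0 _).
apply: (le_trans (lee_wpmul2l (_ : (0 <= _%:E)%E) (dyadic_sum_le e0 hp lfin))).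
  by rewrite lee_fin.
have L0 : (0 <= L_eps nu eps p)%E.
  apply: le_trans (le_L_eps e0 hp lfin); rewrite mule_ge0//.
    by rewrite lee_fin; lra.
  by apply: nneseries_ge0 => j _ _; rewrite lee_fin mulr_ge0 ?powR_ge0// sqr_ge0.
have lamn0 : lam != 0 by rewrite gt_eqF.
have nn0 : n%:R != 0 :> R by rewrite gt_eqF.
move: L0; case: (L_eps nu eps p) => [L|_|//].
  move=> L0; rewrite -!EFinM -?EFinD -?EFinM lee_fin le_eqVlt.
  apply/orP; left; apply/eqP; rewrite -/lam /K /h.
  by field; rewrite lamn0 nn0.
(* If [L_eps] is infinite, all other factors are positive and the right-hand side is [+oo]. *)
rewrite gt0_mulye; last by rewrite lte_fin invr_gt0 exprn_gt0.
rewrite [leRHS](_ : _ = +oo%E) ?leey// addey// gt0_muley ?lte_fin// gt0_mulye//.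
by rewrite lte_fin divr_gt0 ?exprn_gt0.
Qed.
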